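(* For positive integers $a$ and $n$ let $$R(n;a)=\#\left\{(x,y)\in\mathbb{N}^2:\ \frac{a}{n}=\frac1x+\frac1y\right\},$$ for $N\ge1$ let $S(N;a)=\sum_{n\le N,\,(n,a)=1}R(n;a)$, and let $$U(N)=\sum_{a\in\mathbb{N}}S(N;a).$$ Then, for $N\ge 2$, $$U(N)=\frac14 C N(\log N)^3+O\big(N(\log N)^2\big),\qquad\text{where } C=\prod_p\left(1-3p^{-2}+2p^{-3}\right),$$ the product being over all primes $p$.
   Context: $\mathbb{N}$ denotes the positive integers. The sum defining $U(N)$ is finite since $R(n;a)=0$ whenever $a>2n$. *)

(* Defs.v *)
From HB Require Import structures.
From mathcomp Require Import all_boot all_order all_algebra.
From mathcomp Require Import all_classical all_reals all_analysis.
Set Implicit Arguments. Unset Strict Implicit. Unset Printing Implicit Defensive.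
Import Order.TTheory GRing.Theory Num.Theory.

(* R(n;a) = #{(x,y) in N^2, x,y >= 1 : a/n = 1/x + 1/y}.
   For n >= 1, a/n = 1/x + 1/y  <=>  a*x*y = n*(x+y) (x,y >= 1), and every
   solution satisfies x, y <= 2 n^2, so counting over x, y < 2 n^2 + 1
   counts all solutions. *)
Definition Rsol (n a : nat) : nat :=
  let B := (2 * n ^ 2).+1 in
  #|[set p : 'I_B * 'I_B |
      [&& 0 < (p.1 : nat), 0 < (p.2 : nat) &
          a * ((p.1 : nat) * p.2) == n * ((p.1 : nat) + p.2)]]|.

Definition Ssum (N a : nat) : nat :=
  \sum_(1 <= n < N.+1 | coprime n a) Rsol n a.

(* U(N) = sum_{a >= 1} S(N;a); R(n;a) = 0 for a > 2n, so terms with a > 2N vanish *)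
Definition Usum (N : nat) : nat :=
  \sum_(1 <= a < (2 * N).+1) Ssum N a.

Definition Cpartial (R : realType) (M : nat) : R :=
  (\prod_(p < M | prime p)
     (1 - 3 / (p%:R) ^+ 2 + 2 / (p%:R) ^+ 3))%R.

(* Main.v *)
(** Write a solution of a/n = 1/x + 1/y with (n,a) = 1 as x = gu, y = gv with
    (u,v) = 1.  Then uv | n, say n = huv, and a | u + v, g = h(u + v)/a; so U(N)
    counts quadruples (h,u,v,e) with huv <= N, (u,v) = 1, e | u + v and
    (e,h) = 1.  By symmetry it is, up to O(N), twice the count with u < v.
    Putting u + v = ek, one counts (h,u,e,k) with 2u < ek and hu(ek - u) <= N
    such that (e,hu) = (k,u) = 1.

    Without the coprimality conditions, but with a | h, b | u, c | e, d | k, the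
    count is N (log N)^3 / (8abcd) up to
    O(N (1 + log N)^2 (1 + log(abcd)) / (abcd)): for fixed h, u the pair (e,k)
    contributes about x log x with x = N/(hu), and the error O(x) per (h,u) is
    already affordable.  The conditions are then inserted one prime at a time;
    each prime p multiplies the main term by 1 - 3/p^2 + 2/p^3 and the error by
    at most 1 + 15(1 + log p)/p^2, whose product over all primes converges.  The
    resulting estimate holds with the partial product over p < M for every large
    M, uniformly in M, and M tends to infinity at the end. *)
Require Import Defs.
From HB Require Import structures.
From mathcomp Require Import all_boot all_order all_algebra.
From mathcomp Require Import all_classical all_reals all_analysis.
From mathcomp Require Import zify ring lra.
Import Order.TTheory GRing.Theory Num.Theory numFieldNormedType.Exports.
Local Open Scope classical_set_scope.
Local Open Scope ring_scope.
Set Implicit Arguments.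
Unset Strict Implicit.
Unset Printing Implicit Defensive.

(** * Harmonic sums *)

Definition harm (R : realType) (n : nat) : R := \sum_(1 <= i < n.+1) i%:R^-1.

Lemma harmS (R : realType) n : harm R n.+1 = harm R n + n.+1%:R^-1.
Proof. by rewrite /harm big_nat_recr. Qed.

Lemma harm0 (R : realType) : harm R 0 = 0.
Proof. by rewrite /harm big_geq. Qed.

Lemma harm_ge0 (R : realType) n : 0 <= harm R n.
Proof. by apply: sumr_ge0 => i _; rewrite invr_ge0. Qed.

Lemma le_ln_nat (R : realType) (m n : nat) :
  (0 < m)%N -> (m <= n)%N -> ln (m%:R : R) <= ln n%:R.
Proof.
by move=> m0 mn; rewrite ler_ln ?posrE ?ltr0n ?ler_nat //; apply: leq_trans mn.
Qed.

Lemma ln_nat_ge0 (R : realType) n : 0 <= ln (n%:R : R).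
Proof. by case: n => [|n]; [rewrite ln0 | rewrite ln_ge0 ?ler1n]. Qed.

Lemma lnM_nat (R : realType) (m n : nat) : (0 < m)%N -> (0 < n)%N ->
  ln ((m * n)%:R : R) = ln m%:R + ln n%:R.
Proof. by move=> m0 n0; rewrite natrM lnM ?posrE ?ltr0n. Qed.

Lemma ln2_le1 (R : realType) : ln (2 : R) <= 1.
Proof.
have -> : 2 = 1 + 1 :> R by ring.
by apply: le_ln1Dx; lra.
Qed.

Lemma ln_nat_le (R : realType) n : ln (n.+1%:R : R) <= n%:R.
Proof.
rewrite -natr1 addrC; apply: le_ln1Dx.
by have := ler0n R n; move=> *; lra.
Qed.

(** Both bounds are ln(1 + t) <= t, taken at t = -1/(n+1) and at t = 1/n. *)
Lemma ln_step (R : realType) n : (0 < n)%N ->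
  n.+1%:R^-1 <= ln (n.+1%:R : R) - ln n%:R <= n%:R^-1.
Proof.
move=> n0; have np : (0 : R) < n%:R by rewrite ltr0n.
have n1p : (0 : R) < n.+1%:R by rewrite ltr0n.
have n1E : n.+1%:R = n%:R + 1 :> R by rewrite natr1.
have v0 : (0 : R) < n%:R^-1 by rewrite invr_gt0.
have v1 : (0 : R) < n.+1%:R^-1 by rewrite invr_gt0.
apply/andP; split.
  rewrite -lerN2 opprB -ln_div ?posrE //.
  have -> : n%:R / n.+1%:R = 1 + (- n.+1%:R^-1) :> R.
    by rewrite n1E; field; lra.
  apply: le_ln1Dx; rewrite ltrN2 invf_lt1 // n1E; lra.
rewrite -ln_div ?posrE //.
have -> : n.+1%:R / n%:R = 1 + n%:R^-1 :> R by rewrite n1E; field; lra.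
by apply: le_ln1Dx; lra.
Qed.

Lemma harm_ge (R : realType) n : ln (n.+1%:R : R) <= harm R n.
Proof.
elim: n => [|n IH]; first by rewrite harm0 ln1.
rewrite harmS; have /andP[_] := ln_step R (ltn0Sn n).
by move: (n.+1%:R^-1) => y ?; lra.
Qed.

Lemma harm_le (R : realType) n : harm R n <= 1 + ln (n%:R : R).
Proof.
case: n => [|n]; first by rewrite harm0 ln0; lra.
elim: n => [|n IH]; first by rewrite /harm big_nat1 ln1 invr1; lra.
rewrite harmS; have /andP[+ _] := ln_step R (ltn0Sn n).
by move: (n.+2%:R^-1) => y ?; lra.
Qed.

Definition lnharm (R : realType) (n : nat) : R :=
  \sum_(1 <= i < n.+1) ln i%:R / i%:R.

Lemma lnharmS (R : realType) n :
  lnharm R n.+1 = lnharm R n + ln n.+1%:R / n.+1%:R.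
Proof. by rewrite /lnharm big_nat_recr. Qed.

(** One step of comparing the sum of ln i / i with (ln n)^2 / 2: here x = n, l = ln n and l' =
    ln(n+1). After the rewriting into l' ((x+1)^-1 - (l' - l)) + (l' - l)^2 / 2, the two parts have
    opposite signs and each is at most 1/(x+1) in size. *)
Lemma lnharm_step (R : realType) (x l l' : R) : 1 <= x -> 0 <= l' -> l' <= x ->
  (x + 1)^-1 <= l' - l -> l' - l <= x^-1 ->
  `|l' / (x + 1) - (l' ^+ 2 - l ^+ 2) / 2| <= (x + 1)^-1.
Proof.
move=> x1 l'0 l'x d1 d2.
have xx : x^-1 - (x + 1)^-1 = x^-1 * (x + 1)^-1 by field; apply/andP; split; lra.
have y0 : 0 <= (x + 1)^-1 by rewrite invr_ge0; lra.
have z1 : x * x^-1 = 1 by rewrite divff; lra.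
have z1' : x^-1 <= 1 by rewrite invf_le1; lra.
have zy : x^-1 * (x + 1)^-1 <= (x + 1)^-1 by apply: ler_piMl.
have -> : l' / (x + 1) - (l' ^+ 2 - l ^+ 2) / 2 =
   l' * ((x + 1)^-1 - (l' - l)) + (l' - l) ^+ 2 / 2 by field; lra.
move: d1 d2 xx y0 z1 zy z1'; move: (x + 1)^-1 (x^-1) (l' - l) => y z d.
move=> d1 d2 xx y0 z1 zy z1'.
have lo : l' * (d - y) <= x * (z * y) by apply: ler_pM => //; lra.
have hi : 0 <= l' * (d - y) by apply: mulr_ge0 => //; lra.
rewrite mulrA z1 mul1r in lo.
have d2z : d ^+ 2 <= z by rewrite expr2 -[z]mulr1; apply: ler_pM; lra.
have d20 := sqr_ge0 d.
by rewrite ler_norml; apply/andP; split; lra.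
Qed.

Lemma lnharm_est (R : realType) n : (0 < n)%N ->
  `|lnharm R n - ln n%:R ^+ 2 / 2| <= 1 + ln n%:R.
Proof.
(* The steps cost 1/(n+1) each, so the error bound that passes through the induction is
   [harm R n]. *)
move=> n0; apply: le_trans (harm_le R n).
elim: n n0 => // -[_ _|n /(_ isT) IH _].
  by rewrite /lnharm big_nat1 ln1 mul0r expr0n /= mul0r subrr normr0 harm_ge0.
rewrite lnharmS harmS.
have -> : lnharm R n.+1 + ln n.+2%:R / n.+2%:R - ln n.+2%:R ^+ 2 / 2 =
  (lnharm R n.+1 - ln n.+1%:R ^+ 2 / 2) +
  (ln n.+2%:R / n.+2%:R - (ln n.+2%:R ^+ 2 - ln n.+1%:R ^+ 2) / 2) by ring.
apply: (le_trans (ler_normD _ _)); apply: lerD => //.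
have /andP[d1 d2] := ln_step R (ltn0Sn n).
have l'n := ln_nat_le R n.+1; have l'0 := ln_nat_ge0 R n.+2.
have np : 1 <= n.+1%:R :> R by rewrite ler1n.
have n2 : n.+2%:R = n.+1%:R + 1 :> R by rewrite natr1.
by rewrite {2}n2 [in leRHS]n2; apply: lnharm_step => //; rewrite -n2.
Qed.

Lemma ler_dist_sum_nat (R : realType) (m n : nat) (P : pred nat)
    (F G E : nat -> R) :
  (forall i, (m <= i < n)%N -> P i -> `|F i - G i| <= E i) ->
  `|\sum_(m <= i < n | P i) F i - \sum_(m <= i < n | P i) G i| <=
  \sum_(m <= i < n | P i) E i.
Proof.
move=> FG; rewrite -sumrB big_nat_cond [leRHS]big_nat_cond.
by apply: le_trans (ler_norm_sum _ _ _) (ler_sum _ _) => i /andP[/FG].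
Qed.

Lemma sum_nat_mul_le (V : nmodType) (F : nat -> V) m N : (0 < m)%N ->
  \sum_(1 <= h < N.+1 | (h * m <= N)%N) F h = \sum_(1 <= h < (N %/ m).+1) F h.
Proof.
move=> m0; rewrite [RHS](big_nat_widen _ _ N.+1) ?ltnS ?leq_div //.
by apply: eq_bigl => h; rewrite ltnS leq_divRL.
Qed.

Lemma le_ln_div (R : realType) m N : (0 < m)%N -> (0 < N)%N ->
  ln N%:R - ln m%:R <= ln (N %/ m).+1%:R :> R.
Proof.
move=> m0 N0; rewrite lerBlDl -lnM_nat // le_ln_nat // mulnC.
by rewrite ltnW // ltn_ceil.
Qed.

Lemma ln_div_le (R : realType) m N : (0 < N %/ m)%N ->
  ln (N %/ m)%:R <= ln N%:R - ln m%:R :> R.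
Proof.
move=> y0; have m0 : (0 < m)%N by case: m y0.
by rewrite lerBrDl -lnM_nat // le_ln_nat ?muln_gt0 ?m0 // mulnC leq_trunc_div.
Qed.

Lemma lnS_le (R : realType) n : (0 < n)%N -> ln n.+1%:R <= 1 + ln n%:R :> R.
Proof.
move=> n0; have := ln2_le1 R; rewrite -[2]/(2%:R) => ln2.
apply: le_trans (_ : ln (2 * n)%:R <= _); first by apply: le_ln_nat; lia.
by rewrite lnM_nat // lerD2r.
Qed.

(** The real-number core of [log_weight_sum]: L = ln N, l = ln u, w is the logarithm of the integer
    part of N/u^2, and H, S stand for [harm] and [lnharm] at that integer part. *)
Lemma log_integral_error (R : realType) (H S L l w : R) :
  0 <= l -> 0 <= w -> w <= L - 2 * l -> L - 2 * l <= 1 + w ->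
  L - 2 * l <= H -> H <= 1 + w -> `|S - w ^+ 2 / 2| <= 1 + w ->
  `|(L - l) * H - S - (L - 2 * l) * L / 2| <= 1 + 3 * L.
Proof.
move=> l0 w0 wt tw tH Hw; rewrite ler_norml => /andP[S1 S2].
have p1 : 0 <= (L - l) * (H - (L - 2 * l)) by apply: mulr_ge0; lra.
have p2 : (L - l) * (H - (L - 2 * l)) <= L * 1 by apply: ler_pM; lra.
have p3 : 0 <= (L - 2 * l - w) * (L - 2 * l + w) by apply: mulr_ge0; lra.
have p4 : (L - 2 * l - w) * (L - 2 * l + w) <= 1 * (2 * L) by apply: ler_pM; lra.
by rewrite ler_norml; apply/andP; split; lra.
Qed.

(* With L = ln N and l = ln u the sum is
   (L - l)(L - 2l) - (L - 2l)^2 / 2 = (L - 2l) L / 2 up to O(1 + L). *)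
Lemma log_weight_sum (R : realType) N u : (0 < u)%N -> (u ^ 2 <= N)%N ->
  `|\sum_(1 <= h < (N %/ u ^ 2).+1) h%:R^-1 * (ln N%:R - ln (h * u)%:R) -
    (ln N%:R - 2 * ln u%:R) * ln N%:R / 2| <= 1 + 3 * ln N%:R :> R.
Proof.
move=> u0 uN; have u20 : (0 < u ^ 2)%N by rewrite expn_gt0 u0.
have y0 : (0 < N %/ u ^ 2)%N by rewrite divn_gt0.
have N0 : (0 < N)%N by apply: leq_trans uN.
have -> : \sum_(1 <= h < (N %/ u ^ 2).+1) h%:R^-1 * (ln N%:R - ln (h * u)%:R) =
  (ln N%:R - ln u%:R) * harm R (N %/ u ^ 2) - lnharm R (N %/ u ^ 2).
  rewrite /harm /lnharm mulr_sumr -sumrB big_nat_cond [RHS]big_nat_cond.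
  apply: eq_bigr => h /andP[/andP[h0 _] _]; rewrite lnM_nat //; ring.
have l2 : ln (u ^ 2)%:R = 2 * ln u%:R :> R by rewrite natrX lnXn ?ltr0n // mulr_natl.
have := le_ln_div R u20 N0; have := ln_div_le R y0; rewrite l2 => a b.
apply: (@log_integral_error _ _ _ _ _ (ln (N %/ u ^ 2)%:R)).
- exact: ln_nat_ge0.
- exact: ln_nat_ge0.
- exact: a.
- exact: le_trans b (lnS_le R y0).
- exact: le_trans b (harm_ge R _).
- exact: harm_le.
- exact: lnharm_est.
Qed.

Lemma exists_sqrtn N : exists s, (s ^ 2 <= N < s.+1 ^ 2)%N.
Proof.
elim: N => [|N [s /andP[s1 s2]]]; first by exists 0%N.
by case: (ltnP N.+1 (s.+1 ^ 2)) => Ns; [exists s | exists s.+1]; lia.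
Qed.

(** With x = N/(hu), the summand is x ln x divided by N. The range h u^2 <= N is the region where
    the window for (h,u) is nonempty; r = a b^2 appears when h and u run over multiples of a and
    b. *)
Definition hyperbolic_log_sum (R : realType) (r N : nat) : R :=
  \sum_(1 <= u < N.+1) \sum_(1 <= h < N.+1 | (h * (r * u ^ 2) <= N)%N)
    (u%:R^-1 * h%:R^-1) * (ln N%:R - ln (h * u)%:R).

(** By [log_weight_sum] the sum over h is about (L - 2 ln u) L / 2. Weighting by 1/u and summing
    over u <= sqrt N gives (L^2/2)(L/2) - L (L/2)^2/2 = L^3/8. *)
Lemma hyperbolic_log_sum_est (R : realType) N : (0 < N)%N ->
  `|hyperbolic_log_sum R 1 N - ln N%:R ^+ 3 / 8| <= 5 * (1 + ln N%:R) ^+ 2.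
Proof.
move=> N0; have [s /andP[sN Ns]] := exists_sqrtn N.
have s0 : (0 < s)%N by case: s {sN} Ns => //; rewrite exp1n; lia.
have sN' : (s <= N)%N by apply: leq_trans sN; rewrite expnS expn1 leq_pmull.
have L0 := ln_nat_ge0 R N.
(* For u > s the range of h is empty, because u^2 > N. *)
have -> : hyperbolic_log_sum R 1 N = \sum_(1 <= u < s.+1) u%:R^-1 *
    \sum_(1 <= h < (N %/ u ^ 2).+1) h%:R^-1 * (ln N%:R - ln (h * u)%:R).
  rewrite /hyperbolic_log_sum (big_cat_nat _ (n := s.+1)) //=.
  rewrite [X in _ + X]big_nat_cond [X in _ + X]big1 ?addr0; last first.
    move=> u /andP[/andP[su _] _];
    rewrite mul1n sum_nat_mul_le ?expn_gt0 ?(leq_trans _ su) //.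
    by rewrite divn_small ?big_geq //; apply: leq_trans Ns _; rewrite leq_exp2r.
  apply: eq_big_nat => u /andP[u0 _]; rewrite mul1n sum_nat_mul_le ?expn_gt0 ?u0 //.
  by rewrite mulr_sumr; apply: eq_bigr => h _; rewrite mulrA.
have main : `|\sum_(1 <= u < s.+1) u%:R^-1 *
    \sum_(1 <= h < (N %/ u ^ 2).+1) h%:R^-1 * (ln N%:R - ln (h * u)%:R) -
    \sum_(1 <= u < s.+1) u%:R^-1 * ((ln N%:R - 2 * ln u%:R) * ln N%:R / 2)| <=
    \sum_(1 <= u < s.+1) u%:R^-1 * (1 + 3 * ln N%:R) :> R.
  apply: ler_dist_sum_nat => u /andP[u0 us] _; rewrite -mulrBr normrM.
  rewrite ger0_norm ?invr_ge0 // ler_wpM2l ?invr_ge0 //; apply: log_weight_sum => //.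
  by apply: leq_trans sN; rewrite leq_exp2r.
have E2 : \sum_(1 <= u < s.+1) u%:R^-1 * ((ln N%:R - 2 * ln u%:R) * ln N%:R / 2)
    = ln N%:R ^+ 2 / 2 * harm R s - ln N%:R * lnharm R s.
  rewrite /harm /lnharm !mulr_sumr -sumrB; apply: eq_bigr => u _.
  by move: (u%:R^-1) => y; field.
rewrite E2 -mulr_suml -/(harm R s) in main.
have s1 : 2 * ln s%:R <= ln N%:R :> R.
  by rewrite mulr_natl -lnXn ?ltr0n // -natrX le_ln_nat // expn_gt0 s0.
have s2 : ln N%:R <= 2 * ln s.+1%:R :> R.
  by rewrite mulr_natl -lnXn ?ltr0n // -natrX le_ln_nat // ltnW.
have s3 := lnS_le R s0; have H1 := harm_ge R s; have H2 := harm_le R s.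
have := lnharm_est R s0; have := ln_nat_ge0 R s.
move: main; rewrite !ler_norml.
move: (hyperbolic_log_sum R 1 N) => _.
move: (\sum_(1 <= u < s.+1) _) s1 s2 s3 H1 H2 L0.
move: (ln N%:R) (ln s%:R) (ln s.+1%:R) (harm R s) (lnharm R s).
move=> L m m' H S Q s1 s2 s3 H1 H2 L0 /andP[a1 a2] m0 /andP[b1 b2].
have c1 : H * (1 + 3 * L) <= (1 + L) * (1 + 3 * L) by apply: ler_pM; lra.
have c2 : L ^+ 2 * (H - L / 2) <= L ^+ 2 * 1 by apply: ler_pM; rewrite ?sqr_ge0; lra.
have c3 : 0 <= L ^+ 2 * (H - L / 2) by apply: mulr_ge0; rewrite ?sqr_ge0; lra.
have c4 : 0 <= (L / 2 - m) * (L / 2 + m) by apply: mulr_ge0; lra.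
have c5 : (L / 2 - m) * (L / 2 + m) <= 1 * L by apply: ler_pM; lra.
have c6 : L * ((L / 2 - m) * (L / 2 + m)) <= L * L by apply: ler_pM; lra.
have c7 : 0 <= L * ((L / 2 - m) * (L / 2 + m)) by apply: mulr_ge0; lra.
have c8 : L * (S - m ^+ 2 / 2) <= L * (1 + L) by apply: ler_wpM2l; lra.
have c9 : L * - (1 + L) <= L * (S - m ^+ 2 / 2) by apply: ler_wpM2l; lra.
by apply/andP; split; lra.
Qed.

(** * Counting in dilated lattices *)

Lemma hyperbolic_sum_le (R : realType) (P : nat -> pred nat) N : (0 < N)%N ->
  \sum_(1 <= u < N.+1) \sum_(1 <= h < N.+1 | P u h) u%:R^-1 * h%:R^-1 <=
  (1 + ln N%:R) ^+ 2 :> R.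
Proof.
move=> N0; apply: le_trans (_ : harm R N * harm R N <= _); last first.
  by rewrite expr2; apply: ler_pM; rewrite ?harm_ge0 ?harm_le.
rewrite {1}/harm mulr_suml; apply: ler_sum => u _; rewrite mulr_sumr.
rewrite big_mkcond /=; apply: ler_sum => h _.
by case: ifP; rewrite // mulr_ge0 // invr_ge0.
Qed.

Lemma harm_sub_div_le (R : realType) r y : (0 < r)%N ->
  harm R y - harm R (y %/ r) <= 1 + ln r%:R.
Proof.
move=> r0; case: (posnP y) => [->|y0].
  by rewrite div0n subrr; have := ln_nat_ge0 R r; lra.
have := harm_le R y; have := harm_ge R (y %/ r); have := le_ln_div R r0 y0.
by move=> *; lra.
Qed.

(** For each u the two sums differ only in the h between N/(r u^2) and N/u^2. These h have harmonic
    mass at most 1 + ln r, and the weight is at most ln N. *)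
Lemma hyperbolic_log_sum_dilate (R : realType) r N : (0 < r)%N -> (0 < N)%N ->
  `|hyperbolic_log_sum R 1 N - hyperbolic_log_sum R r N| <=
    (1 + ln N%:R) * (ln N%:R * (1 + ln r%:R)).
Proof.
move=> r0 N0; have L0 := ln_nat_ge0 R N; have r1 := ln_nat_ge0 R r.
apply: le_trans (_ : \sum_(1 <= u < N.+1)
  u%:R^-1 * (ln N%:R * (1 + ln r%:R)) <= _); last first.
  by rewrite -mulr_suml; apply: ler_wpM2r; [apply: mulr_ge0; lra | exact: harm_le].
apply: ler_dist_sum_nat => u /andP[u0 _] _; rewrite mul1n.
have u20 : (0 < u ^ 2)%N by rewrite expn_gt0 u0.
rewrite !sum_nat_mul_le ?muln_gt0 ?r0 ?u0 //.
rewrite (mulnC r) divnMA (big_cat_nat _ (n := (N %/ u ^ 2 %/ r).+1)) ?ltnS ?leq_div //=.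
rewrite [X in X - _]addrC addrK ger0_norm; last first.
  rewrite big_nat_cond sumr_ge0 // => h /andP[/andP[h0 hN] _].
  have h1 : (0 < h)%N by apply: leq_ltn_trans h0.
  rewrite !mulr_ge0 ?invr_ge0 // subr_ge0 le_ln_nat ?muln_gt0 ?h1 ?u0 //.
  rewrite ltnS leq_divRL // in hN; apply: leq_trans hN.
  by rewrite leq_mul2l expnS expn1 leq_pmull ?orbT.
apply: le_trans (_ : u%:R^-1 * (ln N%:R *
    (harm R (N %/ u ^ 2) - harm R (N %/ u ^ 2 %/ r))) <= _); last first.
  by rewrite !ler_wpM2l ?invr_ge0 // harm_sub_div_le.
have -> : harm R (N %/ u ^ 2) - harm R (N %/ u ^ 2 %/ r) =
    \sum_((N %/ u ^ 2 %/ r).+1 <= h < (N %/ u ^ 2).+1) h%:R^-1.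
  rewrite /harm (big_cat_nat _ (n := (N %/ u ^ 2 %/ r).+1)) ?ltnS ?leq_div //=.
  by rewrite [X in X - _]addrC addrK.
rewrite !mulr_sumr; apply: ler_sum_nat => h /andP[h0 _].
rewrite -mulrA ler_wpM2l ?invr_ge0 // mulrC ler_wpM2r ?invr_ge0 //.
by rewrite gerBl ln_nat_ge0.
Qed.

Lemma big_dvdn_reindex (T : Type) (idx : T) (op : Monoid.law idx) (F : nat -> T) m n :
    (0 < m)%N ->
  \big[op/idx]_(1 <= i < n.+1 | (m %| i)%N) F i =
  \big[op/idx]_(1 <= j < (n %/ m).+1) F (m * j)%N.
Proof.
move=> m0; elim: n => [|n IH]; first by rewrite div0n !big_geq.
rewrite big_mkcond big_nat_recr //= -big_mkcond IH divnS //.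
case: ifP => [md|_]; last by rewrite add0n Monoid.mulm1.
rewrite add1n [in RHS]big_nat_recr //=; congr (op _ (F _)).
by have := divnK md; rewrite divnS // md mulnC add1n.
Qed.

Lemma count_multiples q m Z n : (0 < q)%N -> (Z %/ q <= n)%N ->
  (\sum_(1 <= k < n.+1 | (m < q * k <= Z)%N) 1)%N = (Z %/ q - m %/ q)%N.
Proof.
move=> q0; set z := (Z %/ q)%N; set w := (m %/ q)%N.
have E k : ((m < q * k <= Z) = (w < k <= z))%N.
  by rewrite mulnC ltn_divLR // leq_divRL.
(* Capping z at n turns the claim into one that can be proved by induction on n. *)
rewrite (eq_bigl _ _ E) => zn; rewrite -[in RHS](minn_idPr zn).
elim: n {zn} => [|n IH]; first by rewrite big_geq // min0n.
rewrite big_mkcond big_nat_recr //= -big_mkcond IH; case: ifP; lia.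
Qed.

Lemma natr_div_bounds (R : realType) q Z : (0 < q)%N ->
  Z%:R / q%:R - 1 <= (Z %/ q)%:R :> R /\ (Z %/ q)%:R <= Z%:R / q%:R :> R.
Proof.
move=> q0; have qp : 0 < q%:R :> R by rewrite ltr0n.
rewrite lerBlDr ler_pdivrMr // ler_pdivlMr // natr1 -!natrM !ler_nat.
by rewrite leq_trunc_div ltnW // ltn_ceil.
Qed.

(** If q > u + V there are no multiples to count and no error. Charging an error of 1 only for q <=
    u + V is what keeps the later sum over q under control. *)
Lemma dist_count_multiples (R : realType) q u V n :
    (0 < q)%N -> (u <= V)%N -> ((u + V) %/ q <= n)%N ->
  `|(\sum_(1 <= k < n.+1 | (2 * u < q * k <= u + V)%N) 1)%N%:R -
    (if (q <= u + V)%N then (V%:R - u%:R) / q%:R else 0)| <=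
  (if (q <= u + V)%N then 1 else 0) :> R.
Proof.
move=> q0 uV Zn; rewrite count_multiples //; case: leqP => qZ; last first.
  by rewrite divn_small // sub0n subr0 normr0.
have uV' : (2 * u <= u + V)%N by rewrite mul2n -addnn leq_add2l.
rewrite natrB ?leq_div2r //.
have [a1 a2] := natr_div_bounds R (u + V) q0.
have [b1 b2] := natr_div_bounds R (2 * u) q0.
have E : (V%:R - u%:R) / q%:R = (u + V)%:R / q%:R - (2 * u)%:R / q%:R :> R.
  by rewrite -mulrBl natrD natrM; congr (_ / _); ring.
rewrite E; move: a1 a2 b1 b2.
move: ((u + V)%:R / q%:R) ((2 * u)%:R / q%:R) ((u + V) %/ q)%:R ((2 * u) %/ q)%:R.
by move=> x y z w *; rewrite ler_norml; apply/andP; split; lra.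
Qed.

(** For V the integer part of N/(hu), the window 2u < ek <= u + V expresses u < v and huv <= N for v
    = ek - u. *)
Definition window_count (u V c d B : nat) : nat :=
  \sum_(1 <= e < B.+1 | (c %| e)%N) \sum_(1 <= k < B.+1 | (d %| k)%N)
    (2 * u < e * k <= u + V)%N.

(** Fix e and count the k. Writing e as c times a new e, the products run over multiples of q = ced,
    giving (V - u)/q with error 1 for each e with ced <= u + V. There are at most (u + V)/(cd) such
    e. *)
Lemma dist_window_count (R : realType) u V c d B :
    (0 < c)%N -> (0 < d)%N -> (u <= V)%N -> (u + V <= B)%N ->
  `|(window_count u V c d B)%:R -
    (V%:R - u%:R) / (c * d)%:R * harm R ((u + V) %/ (c * d))| <=
  (u + V)%:R / (c * d)%:R.
Proof.
move=> c0 d0 uV ZB; set Z := (u + V)%N in ZB *.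
have cd0 : (0 < c * d)%N by rewrite muln_gt0 c0.
have ZBc : (Z %/ (c * d) <= B %/ c)%N.
  by rewrite divnMA (leq_trans (leq_div _ _)) // leq_div2r.
rewrite /window_count big_dvdn_reindex // natr_sum.
have -> : (V%:R - u%:R) / (c * d)%:R * harm R (Z %/ (c * d)) =
  \sum_(1 <= e < (B %/ c).+1)
    (if (c * e * d <= Z)%N then (V%:R - u%:R) / (c * e * d)%:R else 0).
  rewrite -big_mkcond /=.
  rewrite (eq_bigl (fun e => (e * (c * d) <= Z)%N)); last by move=> e; congr leq; lia.
  rewrite /harm mulr_sumr [LHS](big_nat_widen _ _ (B %/ c).+1) //=.
  apply: eq_big => e; first by rewrite ltnS leq_divRL.
  by move=> _; rewrite -mulrA -invfM -natrM; congr (_ / _%:R); lia.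
apply: le_trans (_ : \sum_(1 <= e < (B %/ c).+1)
    (if (c * e * d <= Z)%N then 1 else 0) <= _); last first.
  rewrite -big_mkcond /=.
  rewrite (eq_bigl (fun e => (e * (c * d) <= Z)%N)); last by move=> e; congr leq; lia.
  have [_ H] := natr_div_bounds R Z cd0; apply: le_trans H.
  rewrite -[(Z %/ (c * d))%N in leRHS]subn0 -subSS -sumr_const_nat.
  rewrite [leRHS](big_nat_widen _ _ (B %/ c).+1) //=.
  by rewrite le_eqVlt; apply/orP; left; apply/eqP/eq_bigl => e; rewrite ltnS leq_divRL.
apply: ler_dist_sum_nat => e /andP[e0 eB] _.
rewrite big_dvdn_reindex //.
have -> : (\sum_(1 <= k < (B %/ d).+1) (2 * u < c * e * (d * k) <= Z))%N =
  (\sum_(1 <= k < (B %/ d).+1 | 2 * u < c * e * d * k <= Z) 1)%N.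
  by rewrite [RHS]big_mkcond /=; apply: eq_bigr => k _; rewrite mulnA; case: ifP.
apply: dist_count_multiples => //; first by rewrite !muln_gt0 c0 e0.
rewrite -/Z; apply: leq_trans (leq_div2r d ZB).
by rewrite mulnC divnMA leq_div.
Qed.

(** Replaces (V - U) H by x ln x, where x = N/(hu), V is its integer part, l = ln x, q = ln(cd) and
    H is a harmonic sum. The shift x - V + U is at most 2U. *)
Lemma window_log_error (R : realType) (x V U H l L q : R) :
  1 <= U -> U <= V -> V <= x -> x <= V + 1 -> 0 <= l -> l <= L -> 0 <= q ->
  l - q <= H -> H <= 2 + l ->
  `|(V - U) * H - x * l| <= 2 * U * L + x * (2 + q).
Proof.
move=> U1 UV Vx xV l0 lL q0 H1 H2.
have -> : (V - U) * H - x * l = (V - U) * (H - l) - (x - V + U) * l by ring.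
have a1 : (V - U) * (H - l) <= (V - U) * (2 + q) by apply: ler_wpM2l; lra.
have a2 : (V - U) * - (2 + q) <= (V - U) * (H - l) by apply: ler_wpM2l; lra.
have a3 : (V - U) * (2 + q) <= x * (2 + q) by apply: ler_wpM2r; lra.
have a4 : (x - V + U) * l <= 2 * U * L by apply: ler_pM; lra.
have a5 : 0 <= (x - V + U) * l by apply: mulr_ge0; lra.
by rewrite ler_norml; apply/andP; split; lra.
Qed.

Lemma window_count_est (R : realType) N H U c d B :
    (0 < c)%N -> (0 < d)%N -> (0 < H)%N -> (0 < U)%N -> (H * U ^ 2 <= N)%N ->
    (2 * N <= B)%N ->
  `|(window_count U (N %/ (H * U)) c d B)%:R -
    N%:R / (H * U)%:R * (ln N%:R - ln (H * U)%:R) / (c * d)%:R| <=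
  (2 * U%:R * ln N%:R + N%:R / (H * U)%:R * (4 + ln (c * d)%:R)) / (c * d)%:R
   :> R.
Proof.
move=> c0 d0 H0 U0 HN NB.
have HU0 : (0 < H * U)%N by rewrite muln_gt0 H0.
have cd0 : (0 < c * d)%N by rewrite muln_gt0 c0.
have UV : (U <= N %/ (H * U))%N by rewrite leq_divRL // mulnC -mulnA.
have VN : (N %/ (H * U) <= N)%N by apply: leq_div.
have [v1 v2] := natr_div_bounds R N HU0.
have N0 : (0 < N)%N by lia.
have lx : ln (N%:R / (H * U)%:R) = ln N%:R - ln (H * U)%:R :> R.
  by rewrite ln_div // posrE ltr0n.
have UVB : (U + N %/ (H * U) <= B)%N by lia.
have := dist_window_count R c0 d0 UV UVB.
set V := (N %/ (H * U))%N in UV VN v1 v2 *; set n := ((U + V) %/ (c * d))%N => W.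
have V0 : (0 < V)%N by lia.
have xp : 0 < N%:R / (H * U)%:R :> R by rewrite divr_gt0 ?ltr0n.
have Hlo : ln N%:R - ln (H * U)%:R - ln (c * d)%:R <= harm R n.
  apply: le_trans (harm_ge R n).
  apply: le_trans (_ : ln (U + V)%:R - ln (c * d)%:R <= _); last first.
    by apply: le_ln_div => //; lia.
  rewrite lerD2r -lx ler_ln ?posrE ?ltr0n //; last lia.
  have : V.+1%:R <= (U + V)%:R :> R by rewrite ler_nat; lia.
  by rewrite -natr1; lra.
have lV : ln V%:R <= ln N%:R - ln (H * U)%:R :> R.
  by rewrite -lx ler_ln ?posrE ?ltr0n.
have Hhi : harm R n <= 2 + (ln N%:R - ln (H * U)%:R).
  apply: le_trans (harm_le R n) _.
  have : ln n%:R <= 1 + ln V%:R :> R; last by move=> ?; lra.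
  case: (posnP n) => [->|n0].
    by rewrite ln0 //; have := ln_nat_ge0 R V; move=> ?; lra.
  apply: le_trans (_ : ln (2 * V)%:R <= _).
    apply: le_ln_nat => //; apply: leq_trans (leq_div _ _) _; lia.
  by rewrite lnM_nat // lerD2r ln2_le1.
have U1 : 1 <= U%:R :> R by rewrite ler1n.
have UV' : U%:R <= V%:R :> R by rewrite ler_nat.
have l0 := ln_nat_ge0 R V; have lHU := ln_nat_ge0 R (H * U).
have lcd := ln_nat_ge0 R (c * d).
have E := @window_log_error R (N%:R / (H * U)%:R) V%:R U%:R (harm R n)
  (ln N%:R - ln (H * U)%:R) (ln N%:R) (ln (c * d)%:R).
have {}E : `|(V%:R - U%:R) * harm R n -
    N%:R / (H * U)%:R * (ln N%:R - ln (H * U)%:R)| <=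
  2 * U%:R * ln N%:R + N%:R / (H * U)%:R * (2 + ln (c * d)%:R) :> R.
  by apply: E => //; lra.
have cdp : 0 < (c * d)%:R^-1 :> R by rewrite invr_gt0 ltr0n.
have {}E : `|(V%:R - U%:R) / (c * d)%:R * harm R n -
    N%:R / (H * U)%:R * (ln N%:R - ln (H * U)%:R) / (c * d)%:R| <=
  (2 * U%:R * ln N%:R + N%:R / (H * U)%:R * (2 + ln (c * d)%:R)) / (c * d)%:R :> R.
  rewrite mulrAC -mulrBl normrM (gtr0_norm cdp); exact: (ler_wpM2r (ltW cdp)).
apply: le_trans (ler_distD _ _ _) _; apply: le_trans (lerD W E) _.
(* The constant 4 is the 2 of [window_log_error] plus 2 from U + V <= 2 N/(HU). *)
rewrite -mulrDl; apply: (ler_wpM2r (ltW cdp)).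
rewrite natrD; lra.
Qed.

(** If m is the largest u in range, the sum is at most m^2, and w m^2 <= N. *)
Lemma sum_quadratic_range w n N :
  (w * (\sum_(1 <= u < n.+1 | w * u ^ 2 <= N) u) <= N)%N.
Proof.
elim: n => [|n IH]; first by rewrite big_geq // muln0.
rewrite big_mkcond big_nat_recr //= -big_mkcond; case: (leqP (w * n.+1 ^ 2) N) => [le|_].
  apply: leq_trans le; rewrite leq_mul2l; apply/orP; right.
  apply: leq_trans (_ : \sum_(1 <= u < n.+2) n.+1 <= _)%N.
    rewrite [leqRHS]big_nat_recr //= leq_add2r big_mkcond /=.
    rewrite big_nat_cond [leqRHS]big_nat_cond.
    by apply: leq_sum => i /andP[/andP[_ ?] _]; case: ifP => // _; lia.
  by rewrite sum_nat_const_nat subSS subn0 expnS expn1.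
by rewrite addn0.
Qed.

Definition lattice_count (N a b c d : nat) : nat :=
  \sum_(1 <= h < (2 * N).+1 | (a %| h)%N) \sum_(1 <= u < (2 * N).+1 | (b %| u)%N)
  \sum_(1 <= e < (2 * N).+1 | (c %| e)%N) \sum_(1 <= k < (2 * N).+1 | (d %| k)%N)
    ((2 * u < e * k) && (h * u * (e * k - u) <= N))%N.

(** After h and u are replaced by ah and bu, the window is empty unless (ah)(bu)^2 <= N, so only
    this hyperbolic region survives and the box bounds can be changed. *)
Lemma lattice_countE N a b c d : (0 < a)%N -> (0 < b)%N ->
  lattice_count N a b c d =
  (\sum_(1 <= u < N.+1) \sum_(1 <= h < N.+1 | (h * (a * b ^ 2 * u ^ 2) <= N))
    window_count (b * u) (N %/ (a * h * (b * u))) c d (2 * N))%N.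
Proof.
move=> a0 b0; rewrite /lattice_count big_dvdn_reindex //.
under eq_bigr => h _ do rewrite big_dvdn_reindex //.
rewrite exchange_big /=.
have win h u : (0 < h)%N -> (0 < u)%N ->
  (\sum_(1 <= e < (2 * N).+1 | c %| e) \sum_(1 <= k < (2 * N).+1 | d %| k)
    ((2 * u < e * k) && (h * u * (e * k - u) <= N)) =
   window_count u (N %/ (h * u)) c d (2 * N))%N.
  move=> h0 u0; apply: eq_bigr => e _; apply: eq_bigr => k _.
  congr (nat_of_bool (_ && _)).
  by rewrite mulnC -leq_divRL ?muln_gt0 ?h0 // leq_subLR.
have win0 h u : (0 < h)%N -> (0 < u)%N -> (N < h * u ^ 2)%N ->
    window_count u (N %/ (h * u)) c d (2 * N) = 0%N.
  move=> h0 u0 hu; rewrite /window_count big1 // => e _; rewrite big1 // => k _.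
  have : (N %/ (h * u) < u)%N by rewrite ltn_divLR ?muln_gt0 ?h0 //; lia.
  by case: andP => // -[*]; lia.
pose G u := (\sum_(1 <= h < N.+1 | (h * (a * b ^ 2 * u ^ 2) <= N))
    window_count (b * u) (N %/ (a * h * (b * u))) c d (2 * N))%N.
have GE u : (0 < u)%N -> G u = (\sum_(1 <= h < ((2 * N) %/ a).+1)
    window_count (b * u) (N %/ (a * h * (b * u))) c d (2 * N))%N.
  move=> u0; rewrite /G sum_nat_mul_le ?muln_gt0 ?expn_gt0 ?a0 ?b0 ?u0 //.
  rewrite [RHS](big_cat_nat _ (n := (N %/ (a * b ^ 2 * u ^ 2)).+1)) //=; last first.
    rewrite ltnS -mulnA divnMA (leq_trans (leq_div _ _)) // leq_div2r //; lia.
  rewrite [X in (_ + X)%N]big_nat_cond [X in (_ + X)%N]big1 ?addn0 //.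
  move=> h /andP[/andP[h1 _] _];
  apply: win0; rewrite ?muln_gt0 ?a0 ?b0 ?u0 ?(leq_ltn_trans _ h1) //.
  move: h1; rewrite ltn_divLR ?muln_gt0 ?expn_gt0 ?a0 ?b0 ?u0 //.
  by rewrite expnMn; congr (_ < _)%N; lia.
have G0 u : (N %/ b < u)%N -> G u = 0%N.
  move=> uN; have u0 : (0 < u)%N by apply: leq_ltn_trans uN.
  rewrite /G sum_nat_mul_le ?muln_gt0 ?expn_gt0 ?a0 ?b0 ?u0 //.
  rewrite ltn_divLR // in uN.
  rewrite divn_small ?big_geq //; apply: leq_trans uN _.
  have -> : (a * b ^ 2 * u ^ 2 = a * b * u * (u * b))%N by lia.
  by rewrite leq_pmull // !muln_gt0 a0 b0.
have GS n : (N %/ b <= n)%N ->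
    (\sum_(1 <= u < n.+1) G u = \sum_(1 <= u < (N %/ b).+1) G u)%N.
  move=> n1; rewrite (big_cat_nat _ (n := (N %/ b).+1)) //=.
  rewrite [X in (_ + X)%N]big_nat_cond [X in (_ + X)%N]big1 ?addn0 //.
  by move=> u /andP[/andP[/G0]].
(* [G] vanishes once bu > N, so both upper limits for u give the same sum. *)
rewrite (GS N) ?leq_div // -(GS (2 * N %/ b)%N); last by rewrite leq_div2r //; lia.
apply: eq_big_nat => u /andP[u0 _]; rewrite GE //.
by apply: eq_big_nat => h /andP[h0 _]; rewrite win // muln_gt0 ?a0 ?b0.
Qed.

(** Sums [window_count_est] over the hyperbolic region. The constant is 12 = 2 + 4 + 1 + 5: the
    terms 2UL, the error 4x of the windows, the dilation by r, and [hyperbolic_log_sum_est]. *)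
Lemma lattice_count_est (R : realType) N a b c d :
    (0 < N)%N -> (0 < a)%N -> (0 < b)%N -> (0 < c)%N -> (0 < d)%N ->
  `|(lattice_count N a b c d)%:R - N%:R * ln N%:R ^+ 3 / 8 / (a * b * c * d)%:R|
  <= 12 * N%:R * (1 + ln N%:R) ^+ 2 * (1 + ln (a * b * c * d)%:R) /
     (a * b * c * d)%:R :> R.
Proof.
move=> N0 a0 b0 c0 d0; rewrite lattice_countE // natr_sum.
under eq_bigr => u _ do rewrite natr_sum.
have r0 : (0 < a * b ^ 2)%N by rewrite muln_gt0 a0 expn_gt0 b0.
have cd0 : (0 < c * d)%N by rewrite muln_gt0 c0.
have ab0 : (0 < a * b)%N by rewrite muln_gt0 a0.
set r := (a * b ^ 2)%N in r0 *; set L := ln N%:R; set q := (a * b * c * d)%N.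
have L0 : 0 <= L by apply: ln_nat_ge0.
have Np : 0 < N%:R :> R by rewrite ltr0n.
have abp : 0 < (a * b)%:R :> R by rewrite ltr0n.
have cdp : 0 < (c * d)%:R :> R by rewrite ltr0n.
have qE : q%:R = (a * b)%:R * (c * d)%:R :> R by rewrite -natrM mulnA.
have lq : ln q%:R = ln (a * b)%:R + ln (c * d)%:R :> R by rewrite qE lnM.
(* Since a b^2 <= (ab)^2, the loss from dilating by r is absorbed in 1 + ln(abcd). *)
have lr : ln r%:R <= 2 * ln (a * b)%:R :> R.
  rewrite mulr_natl -lnXn // -natrX; apply: le_ln_nat => //.
  by rewrite /r expnMn leq_mul2r expnS expn1 leq_pmull ?orbT.
have lab := ln_nat_ge0 R (a * b); have lcd := ln_nat_ge0 R (c * d).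
have lr0 := ln_nat_ge0 R r.
pose P u := [pred h | h * (r * u ^ 2) <= N]%N.
pose S := \sum_(1 <= u < N.+1) \sum_(1 <= h < N.+1 | P u h) u%:R^-1 * h%:R^-1 : R.
have S1 : S <= (1 + L) ^+ 2 by apply: hyperbolic_sum_le.
have S0 : 0 <= S.
  by apply: sumr_ge0 => u _; apply: sumr_ge0 => h _; rewrite mulr_ge0 ?invr_ge0.
pose F u h : R := N%:R / (a * h * (b * u))%:R *
  (ln N%:R - ln (a * h * (b * u))%:R) / (c * d)%:R.
pose E u h : R := (2 * (b * u)%:R * ln N%:R +
  N%:R / (a * h * (b * u))%:R * (4 + ln (c * d)%:R)) / (c * d)%:R.
have step1 : `|\sum_(1 <= u < N.+1) \sum_(1 <= h < N.+1 | P u h)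
      (window_count (b * u) (N %/ (a * h * (b * u))) c d (2 * N))%:R -
    \sum_(1 <= u < N.+1) \sum_(1 <= h < N.+1 | P u h) F u h| <=
    \sum_(1 <= u < N.+1) \sum_(1 <= h < N.+1 | P u h) E u h.
  apply: ler_dist_sum_nat => u /andP[u0 _] _.
  apply: ler_dist_sum_nat => h /andP[h0 _] hP.
  apply: window_count_est => //; rewrite ?muln_gt0 ?a0 ?b0 //.
  by move: hP; rewrite /= /r expnMn !mulnA (mulnC a h).
(* The logarithm of ah bu splits off ln(ab), whose total contribution is of the size of the
   error. *)
have FE : \sum_(1 <= u < N.+1) \sum_(1 <= h < N.+1 | P u h) F u h =
    N%:R / q%:R * (hyperbolic_log_sum R r N - ln (a * b)%:R * S).
  rewrite /hyperbolic_log_sum /S mulr_sumr -sumrB mulr_sumr.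
  rewrite big_nat_cond [RHS]big_nat_cond; apply: eq_bigr => u /andP[/andP[u0 _] _].
  rewrite mulr_sumr -sumrB mulr_sumr big_nat_cond [RHS]big_nat_cond.
  apply: eq_bigr => h /andP[/andP[h0 _] _].
  have hu0 : (0 < h * u)%N by rewrite muln_gt0 h0.
  rewrite /F mulnACA.
  rewrite lnM_nat // qE !natrM !invfM; ring.
have EE : \sum_(1 <= u < N.+1) \sum_(1 <= h < N.+1 | P u h) E u h <=
    N%:R / q%:R * (2 * L * (1 + L)) + N%:R / q%:R * ((4 + ln (c * d)%:R) * S).
  have -> : \sum_(1 <= u < N.+1) \sum_(1 <= h < N.+1 | P u h) E u h =
     2 * L / (c * d)%:R *
       (\sum_(1 <= u < N.+1) \sum_(1 <= h < N.+1 | P u h) (b * u)%:R)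
     + N%:R / q%:R * ((4 + ln (c * d)%:R) * S).
    rewrite /S !mulr_sumr -big_split; apply: eq_bigr => u _ /=.
    rewrite !mulr_sumr -big_split; apply: eq_bigr => h _ /=.
    rewrite /E mulnACA.
    by rewrite qE -/L !natrM !invfM; ring.
  rewrite lerD2r.
  rewrite (_ : N%:R / q%:R * _ =
     2 * L / (c * d)%:R * (N%:R / (a * b)%:R * (1 + L))); last first.
    by rewrite qE invfM; ring.
  apply: ler_wpM2l; first by rewrite divr_ge0 ?mulr_ge0 // ltW.
  (* With h fixed and u summed first, [sum_quadratic_range] for w = hr bounds the sum of bu by
     N/(abh); the sum over h then costs only one logarithm. *)
  rewrite (exchange_big_dep_nat predT) //=.
  apply: le_trans (_ : N%:R / (a * b)%:R * harm R N <= _); last first.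
    by apply: ler_wpM2l; [rewrite divr_ge0 ?ltW | exact: harm_le].
  rewrite mulr_sumr; apply: ler_sum_nat => h /andP[h0 _].
  rewrite -mulrA -invfM -natrM ler_pdivlMr ?ltr0n ?muln_gt0 ?a0 ?b0 ?h0 //.
  rewrite -natr_sum -natrM ler_nat.
  have -> : (\sum_(1 <= u < N.+1 | P u h) b * u =
      b * \sum_(1 <= u < N.+1 | h * r * u ^ 2 <= N) u)%N.
    by rewrite big_distrr; apply: eq_bigl => u; rewrite /= mulnA.
  apply: leq_trans (sum_quadratic_range (h * r) N N).
  move: (\sum_(1 <= u < N.+1 | _) u)%N => s; apply: eq_leq; rewrite /r; ring.
have D := hyperbolic_log_sum_dilate R r0 N0.
have C := hyperbolic_log_sum_est R N0.
rewrite -/L in C D.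
apply: le_trans (_ : N%:R / q%:R * (12 * (1 + L) ^+ 2 * (1 + ln q%:R)) <= _); last first.
  by rewrite le_eqVlt; apply/orP; left; apply/eqP; ring.
apply: le_trans (ler_distD _ _ _) _; apply: le_trans (lerD step1 _) _.
  by rewrite FE.
apply: le_trans (lerD EE (lexx _)) _.
have -> : N%:R / q%:R * (hyperbolic_log_sum R r N - ln (a * b)%:R * S) -
    N%:R * L ^+ 3 / 8 / q%:R =
    N%:R / q%:R * (hyperbolic_log_sum R r N - ln (a * b)%:R * S - L ^+ 3 / 8).
  by move: (q%:R^-1) => z; field.
have Nq : 0 <= N%:R / q%:R :> R by rewrite divr_ge0.
rewrite normrM (ger0_norm Nq) -!mulrDr; apply: ler_wpM2l => //.
rewrite lq.
have T : `|hyperbolic_log_sum R r N - ln (a * b)%:R * S - L ^+ 3 / 8| <=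
  (1 + L) * (L * (1 + ln r%:R)) + 5 * (1 + L) ^+ 2 + ln (a * b)%:R * S.
  move: C D; rewrite !ler_norml => /andP[c1 c2] /andP[d1 d2].
  have : 0 <= ln (a * b)%:R * S by apply: mulr_ge0.
  by move=> ?; apply/andP; split; lra.
apply: le_trans (lerD (lexx _) T) _.
have t1 : (4 + ln (c * d)%:R) * S <= (4 + ln (c * d)%:R) * (1 + L) ^+ 2.
  by apply: ler_wpM2l => //; lra.
have t2 : ln (a * b)%:R * S <= ln (a * b)%:R * (1 + L) ^+ 2 by apply: ler_wpM2l.
have t3 : (1 + L) * (L * (1 + ln r%:R)) <= (1 + L) * ((1 + L) * (1 + 2 * ln (a * b)%:R)).
  apply: ler_wpM2l; first lra.
  by apply: ler_pM => //; lra.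
have t4 : L * (1 + L) <= (1 + L) ^+ 2 by rewrite expr2; apply: ler_wpM2r; lra.
have t5 : 0 <= (1 + L) ^+ 2 by apply: sqr_ge0.
have t6 : 0 <= ln (a * b)%:R * (1 + L) ^+ 2 by apply: mulr_ge0.
have t7 : 0 <= ln (c * d)%:R * (1 + L) ^+ 2 by apply: mulr_ge0.
lra.
Qed.

(** * Sieving by primes *)

(** The condition at p of (e,hu) = (k,u) = 1, for (h,u,e,k) = (x1, x2, x3, x4). *)
Definition sifted (I : Type) (x1 x2 x3 x4 : I -> nat) (p : nat) (i : I) : bool :=
  ~~ ((p %| x3 i) && ((p %| x1 i) || (p %| x2 i)))%N &&
  ~~ ((p %| x4 i) && (p %| x2 i))%N.

Definition sieve_count (I : Type) (x1 x2 x3 x4 : I -> nat) (r : seq I)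
    (ps : seq nat) (a b c d : nat) : nat :=
  count (fun i => all (sifted x1 x2 x3 x4 ^~ i) ps &&
    [&& a %| x1 i, b %| x2 i, c %| x3 i & d %| x4 i]%N) r.

Definition sieve_factor (R : realType) (p : nat) : R :=
  1 - 3 / p%:R ^+ 2 + 2 / p%:R ^+ 3.

Definition sieve_loss (R : realType) (p : nat) : R :=
  1 + 15 * ((1 + ln p%:R) / p%:R ^+ 2).

(* With h, u, e, k standing for the indicators of p | x1 i, ..., p | x4 i, the
   condition at p expands as
   (1 - e (h + u - hu)) (1 - ku) = 1 - eh - eu + ehu - ku + eku. *)
Lemma sieve_count_cons (R : realType) I (x1 x2 x3 x4 : I -> nat) (r : seq I)
    ps p a b c d :
    coprime p a -> coprime p b -> coprime p c -> coprime p d ->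
  let S a b c d := (sieve_count x1 x2 x3 x4 r ps a b c d)%:R : R in
  (sieve_count x1 x2 x3 x4 r (p :: ps) a b c d)%:R =
  S a b c d - S (p * a)%N b (p * c)%N d - S a (p * b)%N (p * c)%N d
  + S (p * a)%N (p * b)%N (p * c)%N d - S a (p * b)%N c (p * d)%N
  + S a (p * b)%N (p * c)%N (p * d)%N.
Proof.
have cE P : (count P r)%:R = \sum_(i <- r) (P i)%:R :> R.
  rewrite -sum1_count natr_sum big_mkcond /=.
  by apply: eq_bigr => i _; case: (P i).
move=> pa pb pc pd /=; rewrite /sieve_count !cE -!sumrN -!big_split /=.
apply: eq_bigr => i _; rewrite !Gauss_dvd // /sifted.
case: (all _ ps); rewrite ?andbF ?andFb /=; last by ring.
case: (a %| x1 i)%N; rewrite ?andbF ?andbT /=; last by ring.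
case: (b %| x2 i)%N; rewrite ?andbF ?andbT /=; last by ring.
case: (c %| x3 i)%N; rewrite ?andbF ?andbT /=; last by ring.
case: (d %| x4 i)%N; rewrite ?andbF ?andbT /=; last by ring.
by case: (p %| x1 i)%N; case: (p %| x2 i)%N; case: (p %| x3 i)%N;
  case: (p %| x4 i)%N => /=; ring.
Qed.

(** Here y = 1/p, z = 1/(abcd), lp = ln p, lq = ln(abcd), and the S are the six terms of
    [sieve_count_cons]. As y^3 <= y^2, the five new errors add up to at most y^2 (5 + 12 lp + 5 lq),
    which is below 15 y^2 (1 + lp)(1 + lq). *)
Lemma sieve_step_error (R : realType) (T E B y lp lq z C : R)
    (S0 S1 S2 S3 S4 S5 : R) :
  0 <= E -> 0 <= B -> 0 < z -> 0 <= y -> y <= 1 -> 0 <= lp -> 0 <= lq ->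
  `|S0 - T * z * C| <= E * z * (1 + lq) * B ->
  `|S1 - T * (y ^+ 2 * z) * C| <= E * (y ^+ 2 * z) * (1 + (2 * lp + lq)) * B ->
  `|S2 - T * (y ^+ 2 * z) * C| <= E * (y ^+ 2 * z) * (1 + (2 * lp + lq)) * B ->
  `|S3 - T * (y ^+ 3 * z) * C| <= E * (y ^+ 3 * z) * (1 + (3 * lp + lq)) * B ->
  `|S4 - T * (y ^+ 2 * z) * C| <= E * (y ^+ 2 * z) * (1 + (2 * lp + lq)) * B ->
  `|S5 - T * (y ^+ 3 * z) * C| <= E * (y ^+ 3 * z) * (1 + (3 * lp + lq)) * B ->
  `|(S0 - S1 - S2 + S3 - S4 + S5) -
     T * z * ((1 - 3 * y ^+ 2 + 2 * y ^+ 3) * C)| <=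
  E * z * (1 + lq) * ((1 + 15 * ((1 + lp) * y ^+ 2)) * B).
Proof.
move=> E0 B0 z0 y0 y1 lp0 lq0; rewrite !ler_norml.
move=> /andP[a0 b0] /andP[a1 b1] /andP[a2 b2] /andP[a3 b3] /andP[a4 b4] /andP[a5 b5].
have EB : 0 <= E * z * B by rewrite !mulr_ge0 // ltW.
have Ey : 0 <= E * z * B * y ^+ 2 by rewrite mulr_ge0 // sqr_ge0.
have Ey3 : E * z * B * y ^+ 3 <= E * z * B * y ^+ 2.
  by rewrite (exprS _ 2) mulrCA -{2}[_ * _ * y ^+ 2]mul1r; apply: ler_wpM2r.
have Ey30 : 0 <= E * z * B * y ^+ 3.
  by rewrite mulr_ge0 // exprn_ge0.
have p1 : 0 <= E * z * B * y ^+ 2 * lp by apply: mulr_ge0.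
have p2 : 0 <= E * z * B * y ^+ 2 * lq by apply: mulr_ge0.
have p3 : 0 <= E * z * B * y ^+ 2 * (lp * lq) by apply: mulr_ge0 => //; apply: mulr_ge0.
have p4 : E * z * B * y ^+ 3 * lp <= E * z * B * y ^+ 2 * lp by apply: ler_wpM2r.
have p5 : E * z * B * y ^+ 3 * lq <= E * z * B * y ^+ 2 * lq by apply: ler_wpM2r.
by apply/andP; split; lra.
Qed.

Lemma sieve_estimate (R : realType) I (x1 x2 x3 x4 : I -> nat) (r : seq I)
    (T E : R) (ps : seq nat) :
    0 <= E -> uniq ps -> all prime ps ->
    (forall a b c d, (0 < a)%N -> (0 < b)%N -> (0 < c)%N -> (0 < d)%N ->
      `|(sieve_count x1 x2 x3 x4 r [::] a b c d)%:R - T / (a * b * c * d)%:R| <=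
      E / (a * b * c * d)%:R * (1 + ln (a * b * c * d)%:R)) ->
  `|(count (fun i => all (sifted x1 x2 x3 x4 ^~ i) ps) r)%:R -
    T * \prod_(p <- ps) sieve_factor R p| <=
  E * \prod_(p <- ps) sieve_loss R p.
Proof.
move=> E0 ups pps base.
(* The induction over the primes needs all a, b, c, d coprime to the primes still to be treated,
   since each step moves p into some of them. *)
suff H a b c d : (0 < a)%N -> (0 < b)%N -> (0 < c)%N -> (0 < d)%N ->
    all (coprime^~ (a * b * c * d)%N) ps ->
    `|(sieve_count x1 x2 x3 x4 r ps a b c d)%:R -
      T / (a * b * c * d)%:R * \prod_(p <- ps) sieve_factor R p| <=
    E / (a * b * c * d)%:R * (1 + ln (a * b * c * d)%:R) *
      \prod_(p <- ps) sieve_loss R p.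
  have := H 1%N 1%N 1%N 1%N; rewrite !muln1 ln1 addr0 invr1 !mulr1 /sieve_count.
  rewrite (eq_count (a2 := fun i => all (sifted x1 x2 x3 x4 ^~ i) ps)); last first.
    by move=> i /=; rewrite !dvd1n !andbT.
  by apply=> //; apply/allP => p _; rewrite /= coprimen1.
elim: ps a b c d ups pps => [|p ps IH] a b c d.
  by move=> _ _ a0 b0 c0 d0 _; rewrite !big_nil !mulr1; apply: base.
rewrite /= => /andP[pN ups] /andP[pp pps] a0 b0 c0 d0 /andP[cp cps].
have p0 : (0 < p)%N by apply: prime_gt0.
have q0 : (0 < a * b * c * d)%N by rewrite !muln_gt0 a0 b0 c0.
have /and4P[pa pb pc pd] : [&& coprime p a, coprime p b, coprime p c & coprime p d].
  by move: cp; rewrite !coprimeMr -!andbA.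
rewrite (sieve_count_cons R x1 x2 x3 x4 r ps pa pb pc pd) // !big_cons.
have cpp : all (coprime^~ p) ps.
  apply/allP => t tps; have tP : prime t by apply: (allP pps).
  rewrite /= prime_coprime // dvdn_prime2 //.
  by apply/negP => /eqP tp; rewrite -tp tps in pN.
have cop2 : all (coprime^~ (p * p * (a * b * c * d))%N) ps.
  apply/allP => s sps; move/allP/(_ _ sps): cpp; move/allP/(_ _ sps): cps.
  by rewrite /= !coprimeMr => -> ->.
have cop3 : all (coprime^~ (p * (p * p * (a * b * c * d)))%N) ps.
  apply/allP => s sps; move/allP/(_ _ sps): cpp; move/allP/(_ _ sps): cop2.
  by rewrite /= !coprimeMr => -> ->.
have pp0 : (0 < p * p)%N by rewrite muln_gt0 p0.
have q2 : (0 < p * p * (a * b * c * d))%N by rewrite muln_gt0 pp0.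
have l2 : ln (p * p * (a * b * c * d))%:R =
    2 * ln p%:R + ln (a * b * c * d)%:R :> R.
  by rewrite (lnM_nat R pp0 q0) (lnM_nat R p0 p0); ring.
have l3 : ln (p * (p * p * (a * b * c * d)))%:R =
    3 * ln p%:R + ln (a * b * c * d)%:R :> R.
  by rewrite (lnM_nat R p0 q2) l2; ring.
have i2 : (p * p * (a * b * c * d))%:R^-1 =
    p%:R^-1 ^+ 2 * (a * b * c * d)%:R^-1 :> R.
  by rewrite natrM invfM natrM invfM expr2.
have i3 : (p * (p * p * (a * b * c * d)))%:R^-1 =
    p%:R^-1 ^+ 3 * (a * b * c * d)%:R^-1 :> R.
  by rewrite natrM invfM i2 mulrA -exprS.
have -> : sieve_factor R p = 1 - 3 * p%:R^-1 ^+ 2 + 2 * p%:R^-1 ^+ 3.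
  by rewrite /sieve_factor !exprVn.
have -> : sieve_loss R p = 1 + 15 * ((1 + ln p%:R) * p%:R^-1 ^+ 2).
  by rewrite /sieve_loss exprVn.
(* In three of the new terms p enters two of the four divisors, in the other two it enters three;
   [gen2] and [gen3] treat these cases. *)
have gen2 a' b' c' d' : (a' * b' * c' * d' = p * p * (a * b * c * d))%N ->
    `|(sieve_count x1 x2 x3 x4 r ps a' b' c' d')%:R -
      T * (p%:R^-1 ^+ 2 * (a * b * c * d)%:R^-1) *
      \prod_(p <- ps) sieve_factor R p| <=
    E * (p%:R^-1 ^+ 2 * (a * b * c * d)%:R^-1) *
      (1 + (2 * ln p%:R + ln (a * b * c * d)%:R)) *
      \prod_(p <- ps) sieve_loss R p.
  move=> e; have : (0 < a' * b' * c' * d')%N by rewrite e.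
  rewrite !muln_gt0 => /andP[/andP[/andP[? ?] ?] ?].
  by have := @IH a' b' c' d' ups pps; rewrite e i2 l2; apply.
have gen3 a' b' c' d' : (a' * b' * c' * d' = p * (p * p * (a * b * c * d)))%N ->
    `|(sieve_count x1 x2 x3 x4 r ps a' b' c' d')%:R -
      T * (p%:R^-1 ^+ 3 * (a * b * c * d)%:R^-1) *
      \prod_(p <- ps) sieve_factor R p| <=
    E * (p%:R^-1 ^+ 3 * (a * b * c * d)%:R^-1) *
      (1 + (3 * ln p%:R + ln (a * b * c * d)%:R)) *
      \prod_(p <- ps) sieve_loss R p.
  move=> e; have : (0 < a' * b' * c' * d')%N by rewrite e muln_gt0 p0.
  rewrite !muln_gt0 => /andP[/andP[/andP[? ?] ?] ?].
  by have := @IH a' b' c' d' ups pps; rewrite e i3 l3; apply.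
apply: sieve_step_error => //.
- apply: prodr_ge0 => t _; rewrite addr_ge0 // mulr_ge0 // mulr_ge0 //.
  by rewrite addr_ge0 // ln_nat_ge0.
- by rewrite invr_gt0 ltr0n.
- by rewrite invf_le1 ?ltr0n // ler1n.
- exact: ln_nat_ge0.
- exact: ln_nat_ge0.
- exact: IH.
- apply: gen2; ring.
- apply: gen2; ring.
- apply: gen3; ring.
- apply: gen2; ring.
- apply: gen3; ring.
Qed.

(** * Unit fractions and quadruples *)

(** With g = gcd(x,y) the equation becomes a g uv = n(u + v). As uv is coprime to u + v, it divides
    n = huv; then ag = h(u + v) with a coprime to h, so a divides u + v. *)
Lemma unit_fraction_pair n a x y :
    (0 < n)%N -> (0 < a)%N -> coprime n a -> (0 < x)%N -> (0 < y)%N ->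
    (a * (x * y) = n * (x + y))%N ->
  exists u v, [/\ coprime u v, (u * v %| n)%N, (a %| u + v)%N,
    x = ((u + v) %/ a * (n %/ (u * v)) * u)%N &
    y = ((u + v) %/ a * (n %/ (u * v)) * v)%N].
Proof.
move=> n0 a0 na x0 y0 E; have g0 : (0 < gcdn x y)%N by rewrite gcdn_gt0 x0.
have ux : x = (x %/ gcdn x y * gcdn x y)%N by rewrite divnK ?dvdn_gcdl.
have vy : y = (y %/ gcdn x y * gcdn x y)%N by rewrite divnK ?dvdn_gcdr.
have cuv : coprime (x %/ gcdn x y) (y %/ gcdn x y).
  by rewrite /coprime -(eqn_pmul2r g0) mul1n muln_gcdl -ux -vy.
move: (gcdn x y) (x %/ gcdn x y)%N (y %/ gcdn x y)%N g0 ux vy cuv.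
move=> g u v g0 ux vy cuv; subst x y.
move: x0 y0; rewrite !muln_gt0 g0 !andbT => u0 v0.
have uv0 : (0 < u * v)%N by rewrite muln_gt0 u0.
have {}E : (a * g * (u * v) = n * (u + v))%N.
  apply/eqP; rewrite -(eqn_pmul2r g0); apply/eqP.
  by move: E; rewrite -mulnDl !mulnA => <-; ring.
have cs : coprime (u * v) (u + v).
  by rewrite coprimeMl /coprime gcdnDl gcdnDr (gcdnC v) andbb.
have uvn : (u * v %| n)%N by rewrite -(Gauss_dvdl _ cs) -E dvdn_mull.
have [h nE] := dvdnP uvn.
have h0 : (0 < h)%N by move: n0; rewrite nE; case: (h).
have {}E : (a * g = h * (u + v))%N.
  by apply/eqP; rewrite -(eqn_pmul2r uv0); apply/eqP; rewrite E nE; ring.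
have ha : coprime a h.
  by rewrite coprime_sym; move: na; rewrite nE coprimeMl => /andP[].
have ad : (a %| u + v)%N by rewrite -(Gauss_dvdr _ ha) -E dvdn_mulr.
exists u, v; split=> //; have [d sE] := dvdnP ad.
all: rewrite nE mulnK // sE mulnK // [RHS]mulnC; congr (_ * _)%N.
all: by apply/eqP; rewrite -(eqn_pmul2l a0) E sE; apply/eqP; ring.
Qed.

(** The map (u,v) to (gu,gv) with g = ((u+v)/a)(n/(uv)) is a bijection onto the solutions. The free
    bound m >= n allows one common box for all n. *)
Lemma Rsol_coprime_pairs n a m : (0 < n)%N -> (0 < a)%N -> coprime n a ->
    (n <= m)%N ->
  Rsol n a = (\sum_(1 <= u < m.+1) \sum_(1 <= v < m.+1)
    [&& coprime u v, u * v %| n & a %| u + v])%N.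
Proof.
move=> n0 a0 na nm; rewrite /Rsol; set B := (2 * n ^ 2)%N.
pose g (u v : nat) := ((u + v) %/ a * (n %/ (u * v)))%N.
pose good (u v : nat) := [&& coprime u v, u * v %| n & a %| u + v]%N.
have goodE u v : good u v -> exists h d, [/\ (0 < h)%N, (0 < d)%N,
    (0 < u)%N && (0 < v)%N, n = (h * (u * v))%N & (u + v = d * a)%N] /\ g u v = (d * h)%N.
  case/and3P=> _ uvn av; have [h nE] := dvdnP uvn; have [d sE] := dvdnP av.
  have : (0 < h * (u * v))%N by rewrite -nE.
  rewrite !muln_gt0 => /and3P[h0 u0 v0].
  exists h, d; split; last by rewrite /g nE sE !mulnK // muln_gt0 u0.
  by split=> //; rewrite ?u0 //; case: d sE => //; lia.
(* With n = huv and u + v = da one has g = dh, d <= u + v <= 2n and hu, hv <= n, so the images stay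
   within 2 n^2. *)
have bound u v : good u v -> (g u v * u <= B /\ g u v * v <= B)%N.
  case/goodE=> h [d [[h0 d0 /andP[u0 v0] nE sE] ->]].
  have dle : (d <= u + v)%N by rewrite sE leq_pmulr.
  have hu : (h * u <= n)%N by rewrite nE mulnA leq_pmulr.
  have hv : (h * v <= n)%N by rewrite nE (mulnC u) mulnA leq_pmulr.
  have un : (u <= n)%N by apply: leq_trans hu; rewrite leq_pmull.
  have vn : (v <= n)%N by apply: leq_trans hv; rewrite leq_pmull.
  have BE : B = ((n + n) * n)%N by rewrite /B; ring.
  rewrite BE -!mulnA; split; apply: leq_mul => //; lia.
pose f (p : 'I_m.+1 * 'I_m.+1) : 'I_B.+1 * 'I_B.+1 :=
  (inord (g p.1 p.2 * p.1), inord (g p.1 p.2 * p.2)).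
pose D := [set p : 'I_m.+1 * 'I_m.+1 | good p.1 p.2]%SET.
have finj : {in D &, injective f}.
  move=> [u v] [u' v']; rewrite !inE /= => G G'.
  case=> /(congr1 val) /= e1 /(congr1 val) /= e2.
  have [b1 b2] := bound _ _ G; have [b1' b2'] := bound _ _ G'.
  rewrite !inordK ?ltnS // in e1 e2.
  (* The scale is recovered as gcd(gu,gv) = g, because u and v are coprime. *)
  have gg : g u v = g u' v'.
    case/and3P: G => /eqP c _ _; case/and3P: G' => /eqP c' _ _.
    by rewrite -[LHS]muln1 -c -[RHS]muln1 -c' !muln_gcdr e1 e2.
  have [h [d [[h0 d0 _ _ _] gE]]] := goodE _ _ G'.
  have gp : (0 < g u' v')%N by rewrite gE muln_gt0 d0.
  move/eqP: e1; move/eqP: e2; rewrite gg !eqn_pmul2l //.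
  by move=> /eqP/val_inj -> /eqP/val_inj ->.
transitivity #|f @: D|.
  congr #|pred_of_set _|; apply/setP => -[x y]; rewrite inE /=; apply/idP/imsetP.
    case/and3P=> x0 y0 /eqP E.
    have [u [v [c uvn av xE yE]]] := unit_fraction_pair n0 a0 na x0 y0 E.
    have G : good u v by apply/and3P.
    have [h [d [[h0 d0 /andP[u0 v0] nE sE] gE]]] := goodE _ _ G.
    have um : (u < m.+1)%N.
      by rewrite ltnS (leq_trans _ nm) // nE mulnCA leq_pmulr // muln_gt0 h0.
    have vm : (v < m.+1)%N.
      by rewrite ltnS (leq_trans _ nm) // nE mulnA leq_pmull // muln_gt0 h0.
    exists (Ordinal um, Ordinal vm); first by rewrite inE.
    by rewrite /f /g /= -xE -yE !inord_val.
  move=> [[u v]]; rewrite inE /= => G [-> ->].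
  have [b1 b2] := bound _ _ G; rewrite !inordK ?ltnS //.
  have [h [d [[h0 d0 /andP[u0 v0] nE sE] ->]]] := goodE _ _ G.
  rewrite !muln_gt0 h0 d0 u0 v0 /= -mulnDr sE nE; apply/eqP; ring.
transitivity #|D|; first exact: card_in_imset.
rewrite /D -sum1dep_card.
rewrite big_mkcond /=.
rewrite -(pair_bigA _ (fun u v : 'I_m.+1 => if good u v then 1 else 0)%N) /=.
have good0 u : good 0 u = false.
  by apply/negP => /goodE[h [d [[_ _ /andP[]]]]].
have good0' u : good u 0 = false.
  by apply/negP => /goodE[h [d [[_ _ /andP[]]]]].
rewrite -(big_mkord xpredT (fun u => \sum_(v < m.+1) (if good u v then 1 else 0))%N).
rewrite big_nat_recl // big1 ?add0n; last by move=> v _; rewrite good0.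
rewrite big_add1 /=; apply: eq_bigr => u _.
rewrite -(big_mkord xpredT (fun v => if good u.+1 v then 1 else 0)%N).
rewrite big_nat_recl // good0' add0n big_add1 /=; apply: eq_bigr => v _.
by rewrite -/(good _ _); case: (good _ _).
Qed.

(* A quadruple (h,u,e,k) is encoded as ((h,u),(e,k)); on the region all four
   coordinates are at most 2N, so the box loses nothing. *)
Definition region_quads (N : nat) : seq ((nat * nat) * (nat * nat)) :=
  let s := index_iota 1 (2 * N).+1 in
  [seq x <- allpairs pair (allpairs pair s s) (allpairs pair s s) |
    (2 * x.1.2 < x.2.1 * x.2.2)%N &&
    (x.1.1 * x.1.2 * (x.2.1 * x.2.2 - x.1.2) <= N)%N].

Lemma count_region_quads N (P : pred ((nat * nat) * (nat * nat))) :
  count P (region_quads N) =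
  (\sum_(1 <= h < (2 * N).+1) \sum_(1 <= u < (2 * N).+1)
   \sum_(1 <= e < (2 * N).+1) \sum_(1 <= k < (2 * N).+1)
    [&& 2 * u < e * k, h * u * (e * k - u) <= N & P ((h, u), (e, k))])%N.
Proof.
rewrite count_filter -sum1_count big_mkcond big_allpairs big_allpairs /=.
apply: eq_bigr => h _; apply: eq_bigr => u _; rewrite big_allpairs /=.
apply: eq_bigr => e _; apply: eq_bigr => k _; rewrite andbC -andbA.
by case: ifP.
Qed.

Lemma lattice_count_quads N a b c d :
  lattice_count N a b c d = sieve_count (fun x => x.1.1) (fun x => x.1.2)
    (fun x => x.2.1) (fun x => x.2.2) (region_quads N) [::] a b c d.
Proof.
rewrite /sieve_count count_region_quads /lattice_count big_mkcond.
apply: eq_bigr => h _; case: ifP => ah; last first.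
  rewrite big1 // => u _; rewrite big1 // => e _; rewrite big1 // => k _.
  by rewrite /= !andbF.
rewrite big_mkcond; apply: eq_bigr => u _; case: ifP => bu; last first.
  by rewrite big1 // => e _; rewrite big1 // => k _; rewrite /= !andbF.
rewrite big_mkcond; apply: eq_bigr => e _; case: ifP => ce; last first.
  by rewrite big1 // => k _; rewrite /= !andbF.
rewrite big_mkcond; apply: eq_bigr => k _.
by case: ifP => /=; rewrite ?andbT ?andbF.
Qed.

(** A common prime factor divides m, hence is at most m and lies in s. *)
Lemma coprime_primes m n (s : seq nat) : (0 < m)%N -> (0 < n)%N ->
    all prime s -> (forall p, prime p -> (p <= m)%N -> p \in s) ->
  coprime m n = all (fun p => ~~ ((p %| m) && (p %| n))%N) s.
Proof.
move=> m0 n0 sP sm; rewrite coprime_has_primes // -all_predC; apply/allP/allP => H p.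
  move=> ps; have pP := allP sP _ ps; apply/negP => /andP[pm pn].
  have := H p; rewrite mem_primes pP n0 pn => /(_ isT).
  by rewrite /= mem_primes pP m0 pm.
rewrite mem_primes => /and3P[pP _ pn]; rewrite inE /= mem_primes pP m0 /=.
by apply/negP => pm; have := H p (sm p pP (dvdn_leq m0 pm)); rewrite pm pn.
Qed.

Lemma all_sifted (s : seq nat) h u e k : (0 < h)%N -> (0 < u)%N -> (0 < e)%N ->
    (0 < k)%N -> all prime s ->
    (forall p, prime p -> (p <= maxn e k)%N -> p \in s) ->
  all (sifted (fun x : (nat * nat) * (nat * nat) => x.1.1) (fun x => x.1.2)
    (fun x => x.2.1) (fun x => x.2.2) ^~ ((h, u), (e, k))) s =
  coprime e (h * u) && coprime k u.
Proof.
move=> h0 u0 e0 k0 sP sm.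
rewrite (@coprime_primes e _ s) ?muln_gt0 ?h0 //; last first.
  by move=> p pP pe; apply: sm => //; rewrite leq_max pe.
rewrite (@coprime_primes k _ s) //; last first.
  by move=> p pP pk; apply: sm => //; rewrite leq_max pk orbT.
rewrite -all_predI; apply: eq_in_all => p ps.
by rewrite /sifted /= Euclid_dvdM // (allP sP).
Qed.

Lemma sum_symmetric (F : nat -> nat -> nat) m n : (forall i j, F i j = F j i) ->
  (\sum_(m <= i < n) \sum_(m <= j < n) F i j =
   2 * \sum_(m <= i < n) \sum_(m <= j < n | i < j) F i j + \sum_(m <= i < n) F i i)%N.
Proof.
move=> sym.
have -> : (\sum_(m <= i < n) \sum_(m <= j < n) F i j =
   \sum_(m <= i < n) \sum_(m <= j < n | i < j) F i j +
   \sum_(m <= i < n) \sum_(m <= j < n | j < i) F i j +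
   \sum_(m <= i < n) \sum_(m <= j < n | j == i) F i j)%N.
  rewrite -!big_split; apply: eq_bigr => i _ /=.
  rewrite [in RHS]big_mkcond [X in (_ + X + _)%N]big_mkcond.
  rewrite [X in (_ + _ + X)%N]big_mkcond -!big_split; apply: eq_bigr => j _ /=.
  by case: ltngtP; rewrite ?addn0.
rewrite mul2n -addnn; congr (_ + _ + _)%N.
  under eq_bigr => i _ do rewrite big_mkcond.
  rewrite exchange_big; apply: eq_bigr => i _; rewrite [in RHS]big_mkcond.
  by apply: eq_bigr => j _; rewrite sym.
apply: eq_big_nat => i mi; rewrite big_nat1_eq mi //.
Qed.

(** The contribution of the numerator a = e and the pair (u,v) to U(N). *)
Definition triple_weight (N e u v : nat) : nat :=
  \sum_(1 <= n < N.+1 | coprime n e) [&& coprime u v, u * v %| n & e %| u + v]%N.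

Lemma Usum_triples N : Usum N = (\sum_(1 <= e < (2 * N).+1)
  \sum_(1 <= u < (2 * N).+1) \sum_(1 <= v < (2 * N).+1) triple_weight N e u v)%N.
Proof.
rewrite /Usum; apply: eq_big_nat => e /andP[e0 _]; rewrite /Ssum.
transitivity (\sum_(1 <= n < N.+1 | coprime n e) \sum_(1 <= u < (2 * N).+1)
  \sum_(1 <= v < (2 * N).+1) [&& coprime u v, u * v %| n & e %| u + v])%N.
  rewrite big_nat_cond [RHS]big_nat_cond.
  apply: eq_bigr => n /andP[/andP[n0 nN] ne].
  by apply: Rsol_coprime_pairs => //; lia.
rewrite exchange_big /=; apply: eq_bigr => u _.
by rewrite exchange_big.
Qed.

Lemma triple_weight_sym N e u v : triple_weight N e u v = triple_weight N e v u.
Proof. by apply: eq_bigr => n _; rewrite coprime_sym mulnC addnC. Qed.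

(** On the diagonal u = v coprimality forces u = 1, so e divides 2, and each of the two e
    contributes at most N. *)
Lemma diagonal_weight_le N :
  (\sum_(1 <= e < (2 * N).+1) \sum_(1 <= u < (2 * N).+1) triple_weight N e u u <=
   2 * N)%N.
Proof.
have W e u : (triple_weight N e u u <= (if u == 1 then if e <= 2 then N else 0 else 0))%N.
  rewrite /triple_weight; have [->|u1] := eqVneq u 1%N; last first.
    by rewrite big1 // => n _; rewrite /coprime gcdnn (negbTE u1).
  case: ifP => e2; last first.
    rewrite big1 // => n _; case: (@idP (e %| 1 + 1)%N) => [/dvdn_leq|_].
      by rewrite e2 => /(_ isT).
    by rewrite !andbF.
  rewrite -[leqRHS]subn0 -subSS -[leqRHS]muln1 -sum_nat_const_nat big_mkcond /=.
  by apply: leq_sum => n _; case: ifP => // _; apply: leq_b1.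
case: (posnP N) => [->|N0]; first by rewrite big_geq.
apply: leq_trans (_ : \sum_(1 <= e < (2 * N).+1) (if e <= 2 then N else 0) <= _)%N.
  apply: leq_sum => e _; apply: leq_trans (_ : \sum_(1 <= u < (2 * N).+1)
    (if u == 1 then if e <= 2 then N else 0 else 0) <= _)%N.
    by apply: leq_sum => u _; apply: W.
  rewrite -big_mkcond big_nat1_eq; case: ifP => //.
rewrite (big_cat_nat _ (n := 3)) //=; last lia.
rewrite [X in (_ + X)%N]big_nat_cond [X in (_ + X)%N]big1 ?addn0; last first.
  by move=> e /andP[/andP[e3 _] _]; rewrite leqNgt e3.
by rewrite big_ltn // big_nat1 /=; lia.
Qed.

Lemma triple_weightE N e u v : (0 < u)%N -> (0 < v)%N ->
  triple_weight N e u v = (\sum_(1 <= h < (2 * N).+1)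
    [&& h * u * v <= N, coprime u v, e %| u + v & coprime (h * u * v) e])%N.
Proof.
move=> u0 v0; have uv0 : (0 < u * v)%N by rewrite muln_gt0 u0.
have -> : triple_weight N e u v = (\sum_(1 <= n < N.+1 | u * v %| n)
    [&& coprime u v, e %| u + v & coprime n e])%N.
  rewrite /triple_weight big_mkcond [RHS]big_mkcond; apply: eq_bigr => n _.
  by case: (coprime n e); case: (_ %| n)%N; rewrite ?andbF ?andbT.
rewrite big_dvdn_reindex //.
have -> : (\sum_(1 <= h < (2 * N).+1)
    [&& h * u * v <= N, coprime u v, e %| u + v & coprime (h * u * v) e] =
  \sum_(1 <= h < (2 * N).+1 | h * (u * v) <= N)
    [&& coprime u v, e %| u + v & coprime (u * v * h) e])%N.
  rewrite [RHS]big_mkcond; apply: eq_bigr => h _.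
  by rewrite -!mulnA (mulnC h) -!mulnA; case: ifP.
rewrite (big_nat_widen _ _ (2 * N).+1); last first.
  by rewrite ltnS (leq_trans (leq_div _ _)) //; lia.
by apply: eq_bigl => h; rewrite ltnS leq_divRL.
Qed.

(** Substitutes m = u + v and then m = ek. No term is lost in the box: hu(m - u) <= N and u <= N
    give m <= 2N, and 2u < m excludes m <= u. *)
Lemma sum_window_reindex N e u h (Q : nat -> nat -> bool) :
    (0 < e)%N -> (0 < u)%N -> (0 < h)%N -> (u <= N)%N ->
  (\sum_(1 <= v < (2 * N).+1 | u < v)
     [&& h * u * v <= N, (e %| u + v) & Q v (u + v)] =
   \sum_(1 <= k < (2 * N).+1)
     [&& 2 * u < e * k, h * u * (e * k - u) <= N & Q (e * k - u) (e * k)])%N.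
Proof.
move=> e0 u0 h0 uN.
pose f m := [&& 2 * u < m, h * u * (m - u) <= N & Q (m - u) m]%N.
have f0 m : (2 * N < m)%N -> f m = false.
  move=> Nm; apply/negP => /and3P[um hN _].
  have : (m - u <= h * u * (m - u))%N by rewrite leq_pmull // muln_gt0 h0.
  by lia.
have flow m : (m <= u)%N -> f m = false.
  by move=> mu; apply/negP => /and3P[um _ _]; lia.
have -> : (\sum_(1 <= v < (2 * N).+1 | u < v)
     [&& h * u * v <= N, e %| u + v & Q v (u + v)] =
   \sum_(1 <= v < (2 * N).+1) (if e %| v + u then f (v + u)%N : nat else 0))%N.
  rewrite big_mkcond; apply: eq_bigr => v _; rewrite /f addnK addnC.
  have -> : (2 * u < v + u)%N = (u < v)%N by lia.
  by case: (u < v)%N; case: (e %| _)%N => //=; rewrite ?andbF.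
have -> : (\sum_(1 <= v < (2 * N).+1) (if e %| v + u then f (v + u)%N : nat else 0) =
   \sum_(1 <= m < (2 * N).+1 | e %| m) f m)%N.
  transitivity (\sum_(1 <= m < (2 * N).+1 + u | e %| m) f m)%N.
    rewrite -big_mkcond [RHS](big_cat_nat _ (n := 1 + u)) //=; last lia.
    rewrite big_addn addnK [X in (X + _)%N]big_nat_cond.
    rewrite [X in (X + _)%N]big1 ?add0n // => m /andP[/andP[_ mu] _].
    by rewrite flow.
  rewrite (big_cat_nat _ (n := (2 * N).+1)) //=; last lia.
  rewrite [X in (_ + X)%N]big_nat_cond [X in (_ + X)%N]big1 ?addn0 //.
  by move=> m /andP[/andP[mN _] _]; rewrite f0.
rewrite big_dvdn_reindex //.
rewrite [RHS](big_cat_nat _ (n := (2 * N %/ e).+1)) ?ltnS ?leq_div //=.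
rewrite [X in (_ + X)%N]big_nat_cond [X in (_ + X)%N]big1 ?addn0 //.
move=> k /andP[/andP[kN _] _]; rewrite -/(f (e * k)%N) f0 //.
by rewrite (mulnC e) -ltn_divLR.
Qed.

Lemma Usum_region_quads N : exists2 D, (D <= 2 * N)%N & Usum N =
  (2 * count (fun x => coprime x.2.1 (x.1.1 * x.1.2) && coprime x.2.2 x.1.2)
     (region_quads N) + D)%N.
Proof.
exists (\sum_(1 <= e < (2 * N).+1) \sum_(1 <= u < (2 * N).+1) triple_weight N e u u)%N.
  exact: diagonal_weight_le.
rewrite Usum_triples.
under eq_bigr => e _ do rewrite (sum_symmetric _ _ (triple_weight_sym N e)).
rewrite big_split -big_distrr /=; congr (2 * _ + _)%N.
rewrite count_region_quads exchange_big [RHS]exchange_big /=.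
apply: eq_big_nat => u /andP[u0 uN2]; rewrite [RHS]exchange_big.
apply: eq_big_nat => e /andP[e0 _].
(* For u > N both sides vanish, because huv >= u > N. *)
case: (leqP u N) => [uN|Nu]; last first.
  rewrite big_nat_cond big1 => [|v /andP[/andP[v0 _] uv]].
    rewrite big_nat_cond big1 // => h /andP[/andP[h0 _] _].
    rewrite big1 // => k _; case: ltnP => //= uk.
    by rewrite leqNgt (leq_trans Nu) //= -mulnA mulnCA leq_pmulr // muln_gt0 h0; lia.
  rewrite triple_weightE // big_nat_cond big1 // => h /andP[/andP[h0 _] _].
  by rewrite leqNgt (leq_trans Nu) //= -mulnA mulnCA leq_pmulr // muln_gt0 h0.
transitivity (\sum_(1 <= v < (2 * N).+1 | u < v) \sum_(1 <= h < (2 * N).+1)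
    [&& h * u * v <= N, e %| u + v & (coprime u v && coprime (h * u * v) e)])%N.
  rewrite big_nat_cond [RHS]big_nat_cond.
  apply: eq_bigr => v /andP[/andP[v0 _] _]; rewrite triple_weightE //.
  apply: eq_bigr => h _; congr (nat_of_bool (_ && _)).
  by case: (coprime u v); rewrite ?andbF.
rewrite exchange_big; apply: eq_big_nat => h /andP[h0 _].
rewrite (sum_window_reindex (fun v m => coprime u v && coprime (h * u * v) e)) //.
apply: eq_bigr => k _ /=; case: ltnP => //= uk; congr (nat_of_bool (_ && _)).
(* With v = ek - u, (u,v) = 1 amounts to (u,ek) = 1, and (v,e) = (u,e); the conditions thus collapse
   to (e,hu) = (k,u) = 1. *)
have E : (e * k = u + (e * k - u))%N by lia.
have -> : coprime u (e * k - u) = coprime u e && coprime u k.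
  by rewrite -coprimeMr [in RHS]E /coprime gcdnDl.
rewrite !coprimeMl coprimeMr.
have -> : coprime (e * k - u) e = coprime u e.
  rewrite !(coprime_sym _ e) /coprime; congr (_ == _).
  apply/eqP; rewrite eqn_dvd !dvdn_gcd !dvdn_gcdl /=; apply/andP; split.
    by rewrite -(dvdn_addl _ (dvdn_gcdr _ _)) -E dvdn_mulr // dvdn_gcdl.
  by rewrite -(dvdn_addr _ (dvdn_gcdr _ _)) -E dvdn_mulr // dvdn_gcdl.
by rewrite (coprime_sym e h) (coprime_sym e u) (coprime_sym k u);
  case: (coprime u e); case: (coprime u k); case: (coprime h e).
Qed.

(** * Euler product and conclusion *)

(** With y = 1/n, z = 1/(n+1) and l' = ln(n+1), the right side is at least (3 + l') yz - y^2. Since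
    y <= 2z, this is at least (1 + l') yz; this is where the 3 comes from. *)
Lemma log_over_square_telescope (R : realType) n : (0 < n)%N ->
  (1 + ln n.+1%:R) / n.+1%:R ^+ 2 <=
  (3 + ln n%:R) / n%:R - (3 + ln n.+1%:R) / n.+1%:R :> R.
Proof.
move=> n0; have np : 1 <= n%:R :> R by rewrite ler1n.
have n1E : n.+1%:R = n%:R + 1 :> R by rewrite natr1.
have l0 := ln_nat_ge0 R n.+1.
have /andP[_ d] := ln_step R n0; move: l0 d; rewrite n1E.
move: (n%:R) np (ln (n%:R + 1)) (ln n%:R) => x x1 l' l l'0.
have -> : (1 + l') / (x + 1) ^+ 2 = (1 + l') * (x + 1)^-1 ^+ 2 by rewrite exprVn.
have xy : x^-1 - (x + 1)^-1 = x^-1 * (x + 1)^-1 by field; apply/andP; split; lra.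
have z0 : 0 < (x + 1)^-1 by rewrite invr_gt0; lra.
have y1 : x^-1 <= 1 by rewrite invf_le1; lra.
have y0 : 0 < x^-1 by rewrite invr_gt0; lra.
move: xy z0 y0 y1; move: (x^-1) ((x + 1)^-1) => y z xy z0 y0 y1 d.
have yz : y * z <= 1 * z by apply: ler_wpM2r; lra.
have zy : 0 <= y * z by apply: mulr_ge0; lra.
have c1 : (l' - l) * y <= y * y by apply: ler_wpM2r; lra.
have c2 : y * (2 * z - y) >= 0 by apply: mulr_ge0; lra.
have c3 : z * (y - z) >= 0 by apply: mulr_ge0; lra.
have c4 : l' * (z * (y - z)) >= 0 by apply: mulr_ge0; lra.
have c5 : l' * (y - z) = l' * (y * z) by rewrite xy.
by lra.
Qed.

(** By 1 + t <= exp t and telescoping, the exponent stays below 15 times the starting value 3 of (3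
    + ln n)/n at n = 1. *)
Lemma sieve_loss_prod_le (R : realType) M :
  \prod_(0 <= p < M.+2 | prime p) sieve_loss R p <= expR 45.
Proof.
have pos p : 0 <= 15 * ((1 + ln p%:R) / p%:R ^+ 2) :> R.
  rewrite mulr_ge0 // divr_ge0 // addr_ge0 // ln_nat_ge0 //.
apply: le_trans (_ : expR (15 * (3 - (3 + ln M.+1%:R) / M.+1%:R)) <= _); last first.
  rewrite ler_expR.
  have : 0 <= (3 + ln M.+1%:R) / M.+1%:R :> R.
    by rewrite divr_ge0 // addr_ge0 // ln_nat_ge0.
  by move: (_ / _) => x ?; lra.
elim: M => [|M IH].
  rewrite big_mkcond !big_nat_recl // big_geq //= ln1 !mulr1.
  by rewrite -[X in X <= _]expR0 ler_expR; lra.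
rewrite big_mkcond big_nat_recr //= -big_mkcond /=.
have T := log_over_square_telescope R (ltn0Sn M).
set f := (3 + ln M.+1%:R) / M.+1%:R in IH T *.
set g := (3 + ln M.+2%:R) / M.+2%:R in T *.
have -> : 15 * (3 - g) = 15 * (3 - f) + 15 * (f - g) by ring.
rewrite expRD; apply: ler_pM => //.
- by apply: prodr_ge0 => p _; rewrite addr_ge0.
- by case: ifP => // _; rewrite addr_ge0.
have le1 : 1 + 15 * ((1 + ln M.+2%:R) / M.+2%:R ^+ 2) <= expR (15 * (f - g)) :> R.
  by apply: le_trans (expR_ge1Dx _) _; rewrite ler_expR ler_wpM2l.
by case: ifP => // _; apply: le_trans le1; rewrite lerDl.
Qed.

Lemma sieve_factor_itv (R : realType) p : prime p ->
  0 <= sieve_factor R p <= 1.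
Proof.
move=> pP; have p2 : (2 : R) <= p%:R by rewrite (ler_nat R 2) prime_gt1.
have y0 : 0 < p%:R^-1 :> R by rewrite invr_gt0; lra.
have y1 : p%:R^-1 * 2 <= 1 :> R by rewrite mulrC ler_pdivrMr; lra.
rewrite /sieve_factor -!exprVn; move: (p%:R^-1) y0 y1 => y y0 y1.
have y20 : 0 <= y ^+ 2 by apply: sqr_ge0.
(* The factorization shows that the factor is nonnegative for y = 1/p. *)
have E : 1 - 3 * y ^+ 2 + 2 * y ^+ 3 = (1 - y) ^+ 2 * (1 + 2 * y) by ring.
apply/andP; split; first by rewrite E mulr_ge0 ?sqr_ge0 //; lra.
have : 0 <= y ^+ 2 * (1 - y) by apply: mulr_ge0; lra.
by lra.
Qed.

Lemma Cpartial_prod (R : realType) M :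
  Cpartial R M = \prod_(0 <= p < M | prime p) sieve_factor R p.
Proof. by rewrite big_mkord. Qed.

Lemma Cpartial_cvg (R : realType) : cvgn (Cpartial R).
Proof.
apply: nonincreasing_is_cvgn.
  apply/nonincreasing_seqP => M; rewrite !Cpartial_prod.
  rewrite [leLHS]big_mkcond big_nat_recr //= -big_mkcond /=.
  apply: ler_piMr; first by apply: prodr_ge0 => p /(sieve_factor_itv R)/andP[].
  by case: ifP => // /(sieve_factor_itv R)/andP[].
exists 0 => _ [M _ <-]; rewrite Cpartial_prod.
by apply: prodr_ge0 => p /(sieve_factor_itv R)/andP[].
Qed.

(** All coordinates are at most 2N <= M, so sifting by the primes below M + 2 is exactly the
    coprimality condition. In the constant, 24 is twice 12 by the symmetry in u and v, and 2 is the
    diagonal. *)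
Lemma Usum_Cpartial_est (R : realType) N M : (0 < N)%N -> (2 * N <= M)%N ->
  `|(Usum N)%:R - Cpartial R M.+2 / 4 * N%:R * ln N%:R ^+ 3| <=
  (24 * expR 45 + 2) * N%:R * (1 + ln N%:R) ^+ 2 :> R.
Proof.
move=> N0 NM; have [D DN ->] := Usum_region_quads N.
set s := [seq p <- index_iota 0 M.+2 | prime p].
have sP : all prime s by apply: filter_all.
have su : uniq s by rewrite filter_uniq // iota_uniq.
have E0 : 0 <= 12 * N%:R * (1 + ln N%:R) ^+ 2 :> R.
  by rewrite mulr_ge0 ?sqr_ge0 // mulr_ge0.
have := @sieve_estimate R _ (fun x => x.1.1) (fun x => x.1.2) (fun x => x.2.1)
  (fun x => x.2.2) (region_quads N) (N%:R * ln N%:R ^+ 3 / 8)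
  (12 * N%:R * (1 + ln N%:R) ^+ 2) s E0 su sP.
rewrite !big_filter -Cpartial_prod.
have -> : (count (fun i => all (sifted (fun x : (nat * nat) * (nat * nat) => x.1.1)
    (fun x => x.1.2) (fun x => x.2.1) (fun x => x.2.2) ^~ i) s) (region_quads N) =
  count (fun x => coprime x.2.1 (x.1.1 * x.1.2) && coprime x.2.2 x.1.2)
     (region_quads N))%N.
  rewrite !count_region_quads; apply: eq_big_nat => h /andP[h0 hN].
  apply: eq_big_nat => u /andP[u0 uN]; apply: eq_big_nat => e /andP[e0 eN].
  apply: eq_big_nat => k /andP[k0 kN]; rewrite all_sifted // => p pP pek.
  by rewrite mem_filter pP mem_index_iota /=; lia.
move: (count _ _) => A H.
have {}H : `|A%:R - N%:R * ln N%:R ^+ 3 / 8 * Cpartial R M.+2| <=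
    12 * N%:R * (1 + ln N%:R) ^+ 2 * expR 45 :> R.
  apply: le_trans (H _) _; last by apply: ler_wpM2l => //; apply: sieve_loss_prod_le.
  move=> a b c d a0 b0 c0 d0; rewrite -lattice_count_quads.
  by apply: le_trans (lattice_count_est R N0 a0 b0 c0 d0) _; rewrite mulrAC.
have D0 : 0 <= D%:R :> R by [].
have DN' : D%:R <= 2 * N%:R :> R by rewrite -natrM ler_nat.
have NL : N%:R <= N%:R * (1 + ln N%:R) ^+ 2 :> R.
  by rewrite ler_peMr // exprn_ege1 // lerDl ln_nat_ge0.
rewrite natrD natrM; move: H; rewrite !ler_norml => /andP[H1 H2].
by apply/andP; split; lra.
Qed.

Theorem theorem2 (R : realType) :
  exists C : R,
    (Cpartial R @ \oo --> C) /\
    exists K : R, forall N : nat, (2 <= N)%N ->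
      `| (Usum N)%:R - C / 4 * N%:R * (ln (N%:R : R)) ^+ 3 |
        <= K * N%:R * (ln (N%:R : R)) ^+ 2.
Proof.
exists (limn (Cpartial R)); split; first exact: Cpartial_cvg.
(* The factor 9 comes from (1 + L)^2 <= 9 L^2, which holds since L = ln N >= ln 2 >= 1/2. *)
exists ((24 * expR 45 + 2) * 9) => N N2; have N0 : (0 < N)%N by lia.
set C := limn _.
have bound : `|(Usum N)%:R - C / 4 * N%:R * ln N%:R ^+ 3| <=
    (24 * expR 45 + 2) * N%:R * (1 + ln N%:R) ^+ 2 :> R.
  (* The bound does not depend on M, so M may be taken so large that replacing the partial product
     by its limit costs at most eps. *)
  apply/ler_addgt0Pr => eps eps0.
  have c0 : 0 <= N%:R * ln N%:R ^+ 3 / 4 :> R.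
    by rewrite divr_ge0 // mulr_ge0 // exprn_ge0 // ln_nat_ge0.
  set c := N%:R * ln N%:R ^+ 3 / 4 in c0.
  (* Dividing by 1 + c rather than c avoids a zero denominator and still gives c eps / (1 + c) <=
     eps. *)
  have e0 : 0 < eps / (1 + c) by rewrite divr_gt0 //; lra.
  have [m _ mP] := cvgr_distC_le _ _ (@Cpartial_cvg R) _ e0.
  have := mP (maxn m (2 * N)).+2; rewrite /= => /(_ _)/wrap[]; first by lia.
  set M := maxn m (2 * N) => Cm.
  have U := @Usum_Cpartial_est R N M N0 (leq_maxr _ _).
  have -> : (Usum N)%:R - C / 4 * N%:R * ln N%:R ^+ 3 =
    ((Usum N)%:R - Cpartial R M.+2 / 4 * N%:R * ln N%:R ^+ 3) +
    c * (Cpartial R M.+2 - C) by rewrite /c; field.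
  apply: le_trans (ler_normD _ _) (lerD U _).
  rewrite normrM (ger0_norm c0); apply: le_trans (ler_wpM2l c0 Cm) _.
  rewrite mulrCA; apply: ler_piMr; first exact: ltW.
  by rewrite ler_pdivrMr; lra.
apply: le_trans bound _.
have ln2 : 1 / 2 <= ln N%:R :> R.
  have : ln 2%:R <= ln N%:R :> R by apply: le_ln_nat.
  have /andP[+ _] := ln_step R (ltn0Sn 0); rewrite ln1 subr0.
  by move=> *; lra.
have K0 : 0 <= (24 * expR 45 + 2) * N%:R :> R.
  by rewrite mulr_ge0 // addr_ge0 // mulr_ge0 // expR_ge0.
have L2 : (1 + ln N%:R) ^+ 2 <= 9 * ln N%:R ^+ 2 :> R.
  have -> : 9 * ln N%:R ^+ 2 = (3 * ln N%:R) ^+ 2 :> R by ring.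
  by apply: lerXn2r; rewrite ?nnegrE; lra.
apply: le_trans (ler_wpM2l K0 L2) _.
by rewrite le_eqVlt; apply/orP; left; apply/eqP; ring.
Qed.
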